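(* Let $q\ge 2$ be a fixed integer and let $\boldsymbol\alpha=(\alpha_0,\dots,\alpha_{q-1})\in[0,1]^q$ be a fixed vector with $\alpha_0+\cdots+\alpha_{q-1}=1$. For each large integer $n$ let $k=k(n,q,\boldsymbol\alpha)>0$ be the greatest integer such that $$\binom{n}{k}\binom{k}{k_0,\ldots,k_{q-1}}q^{-k}\ge 1$$ for all choices of $k_i\in\{\lceil\alpha_i k\rceil,\lfloor\alpha_i k\rfloor\}$ ($0\le i\le q-1$) that satisfy $k_0+\cdots+k_{q-1}=k$. Then with high probability $|f(G_{n,1/2},\boldsymbol\alpha,q)-k|=o(n)$; that is, for every $\varepsilon>0$, $$\lim_{n\to\infty}\mathbb P\big[\,|f(G_{n,1/2},\boldsymbol\alpha,q)-k(n,q,\boldsymbol\alpha)|\le\varepsilon n\,\big]=1.$$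
   Context: $G_{n,1/2}$ is the random graph on $n$ labelled vertices in which each unordered pair of distinct vertices is included as an edge independently with probability $1/2$. $\binom{k}{k_0,\ldots,k_{q-1}}=\frac{k!}{k_0!\cdots k_{q-1}!}$ is the multinomial coefficient. For a finite simple graph $G$, $f(G,\boldsymbol\alpha,q)$ is the largest $k$ for which $G$ contains an induced subgraph on $k$ vertices such that, for each $0\le i\le q-1$, the number of vertices of the induced subgraph whose degree in it is congruent to $i\pmod q$ is either $\lfloor\alpha_i k\rfloor$ or $\lceil\alpha_i k\rceil$. *)

(* Defs.v *)
From HB Require Import structures.
From mathcomp Require Import all_boot all_order all_algebra.
From mathcomp Require Import all_classical all_reals all_analysis.

Set Implicit Arguments.
Unset Strict Implicit.
Unset Printing Implicit Defensive.

Import Order.TTheory GRing.Theory Num.Theory.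

Local Open Scope ring_scope.

(* A simple graph on V is given by its edge set, a set of two-element subsets
   of V. *)
Definition sgraph (V : finType) :=
  {E : {set {set V}} | [forall e in E, #|e| == 2%N]}.

Definition adj (V : finType) (G : sgraph V) (u v : V) : bool :=
  [set u; v] \in val G.

Definition induced_deg (V : finType) (G : sgraph V) (S : {set V}) (v : V) :
    nat :=
  #|[set u in S | adj G v u]|.

Definition deg_class (V : finType) (G : sgraph V) (q : nat) (S : {set V})
    (i : nat) : {set V} :=
  [set v in S | induced_deg G S v == i %[mod q]].

Definition floor_or_ceil (R : realType) (x : R) (m : nat) : bool :=
  (m%:Z == Num.floor x) || (m%:Z == Num.ceil x).

Definition deg_distributed (R : realType) (q : nat) (alpha : 'I_q -> R)
    (V : finType) (G : sgraph V) (S : {set V}) : bool :=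
  [forall i : 'I_q, floor_or_ceil (alpha i * #|S|%:R) #|deg_class G q S i|].

(* The empty set always satisfies [deg_distributed], so the default value 0 of
   the maximum is attained. *)
Definition f (R : realType) (q : nat) (alpha : 'I_q -> R) (V : finType)
    (G : sgraph V) : nat :=
  \max_(S : {set V} | deg_distributed alpha G S) #|S|.

Definition Gnp_mass (R : realType) (n : nat) (p : R) (G : sgraph 'I_n) : R :=
  \prod_(e : {set 'I_n} | #|e| == 2%N) (if e \in val G then p else 1 - p).

Definition Gnp_prob (R : realType) (n : nat) (p : R) (A : pred (sgraph 'I_n)) :
    R :=
  \sum_(G : sgraph 'I_n | A G) Gnp_mass p G.

Definition multinomial (R : realType) (q k : nat) (ks : 'I_q -> nat) : R :=
  k`!%:R / \prod_(i < q) (ks i)`!%:R.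

Definition admissible (R : realType) (q : nat) (alpha : 'I_q -> R) (n k : nat) :
    Prop :=
  forall ks : 'I_q -> nat,
    (forall i : 'I_q, floor_or_ceil (alpha i * k%:R) (ks i)) ->
    (\sum_(i < q) ks i)%N = k ->
    1 <= 'C(n, k)%:R * multinomial R k ks * q%:R ^- k.

Definition is_greatest_admissible (R : realType) (q : nat) (alpha : 'I_q -> R)
    (n k : nat) : Prop :=
  [/\ (0 < k)%N, admissible alpha n k
    & forall m : nat, admissible alpha n m -> (m <= k)%N].

(* Main.v *)
(* For a set S of m vertices and a profile t of residues mod q, a Fourier expansion
   writes the probability that G[S] has degrees t as q^-m times a sum over
   frequencies x : S -> Z/q of products of the factors (1 + w^(x_u + x_v)) / 2 over
   the edges uv.  Only constant frequencies x with 2 x = 0 matter, so this probability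
   is q^-m times a bounded factor, and it barely depends on the edges inside a subset
   I of S as long as S minus I has linear size: two sets S, S' with linearly large
   differences are asymptotically independent.

   Let E(m) be the expected number of good m-sets.  Up to a polynomial factor, its
   logarithm is log C(n, m) + m (H(alpha) - log q), strictly concave in m with value 0
   at m = 0, hence linearly negative from k + eps n on and linearly positive between
   n / (8 q) and k - eps n.  The first moment bounds f from above.  Below, choosing the
   class sizes even removes the parity obstruction, and Chebyshev's inequality applies:
   pairs of sets that differ in at most delta n vertices add exp(delta' n) / E(m) to
   the normalised variance, with delta' small against eps. *)

Require Import Defs.
From HB Require Import structures.
From mathcomp Require Import all_boot all_order all_algebra all_field.
From mathcomp Require Import all_classical all_reals all_analysis.
(* Restores the finite-set lemma names shadowed by classical_sets. *)
From mathcomp Require Import fintype finset.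
From mathcomp Require Import ring lra zify.

Set Implicit Arguments.
Unset Strict Implicit.
Unset Printing Implicit Defensive.

Import Order.TTheory GRing.Theory Num.Theory.
Import numFieldNormedType.Exports.

Local Open Scope ring_scope.

(** * Degree conditions modulo q as character sums *)

(** For two sets the expansion runs over pairs of frequencies x, y. On an edge inside both sets only
    the combined phase w^(x_u + x_v + y_u + y_v) appears, and x and y can cancel there, so such
    edges get only the trivial bound. An edge inside just one of the sets carries just one of the
    frequencies; keeping only the gain on those edges, the bound splits into a sum over x times a
    sum over y. These edges suffice because a vertex of S minus S' forms such an edge with every
    other vertex of S.

    Chebyshev's inequality needs the bounds to agree asymptotically, not merely up to a constant.
    With M = [even_residues q], a far pair costs at most (M + eta)^2 times its normalisation, and a
    single profile of even total has probability at least M - eta times its own: the main term is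
    exactly M and the other frequencies amount to at most eta. The normalised second moment is then
    about ((M + eta) / (M - eta))^2. *)

Definition edges (V : finType) : {set {set V}} := [set e : {set V} | #|e| == 2%N].

Definition edge_sum (V : finType) (q : nat) (x : {ffun V -> 'I_q}) (e : {set V}) : nat :=
  (\sum_(v in e) x v)%N.

(* With [a v = q - r v] this says that v has degree r v mod q; the additive form
   keeps every exponent of the root of unity a natural number. *)
Definition deg_cancels (V : finType) (q : nat) (G : sgraph V) (S : {set V}) (a : V -> nat) : bool :=
  [forall v in S, (q %| induced_deg G S v + a v)%N].

(** Expanding the product chooses a subset of the edges, that is, a graph. The independence of the
    edges enters in this form. *)
Lemma sum_graphs_prod (K : comPzRingType) (V : finType) (z : {set V} -> K) :
  \sum_(G : sgraph V) \prod_(e in edges V) (if e \in val G then z e else 1) =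
  \prod_(e in edges V) (1 + z e).
Proof.
transitivity (\sum_(J : {set {set V}} | J \subset edges V)
   \prod_(e in edges V) (if e \in J then z e else 1)).
  rewrite [RHS](reindex_omap (val : sgraph V -> _) insub) /=; last first.
    move=> J /subsetP sJ; rewrite insubT //=.
    by apply/forall_inP => e /sJ; rewrite inE.
  apply: eq_bigl => G; rewrite valK eqxx andbT; apply/esym/subsetP => e eG.
  by rewrite inE; move/forall_inP: (valP G) => /(_ e eG).
pose F (e : {set V}) : K := if e \in edges V then z e else 0.
transitivity (\sum_(J : {set {set V}}) \prod_e (if e \in J then F e else 1)).
  rewrite [RHS](bigID (fun J : {set {set V}} => J \subset edges V)) /=.
  rewrite [X in _ = _ + X]big1 ?addr0 => [|J /subsetPn[e eJ eE]]; last first.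
    by rewrite (bigD1 e) //= eJ /F (negbTE eE) mul0r.
  apply: eq_bigr => J sJ; rewrite big_mkcond; apply: eq_bigr => e _.
  by rewrite /F; case: ifP => // eE; case: ifP => // /(subsetP sJ); rewrite eE.
rewrite -(@bigA_distr K 0 1 _ _ {set V} F (fun=> 1)) [RHS]big_mkcond.
apply: eq_bigr => e _; rewrite /F.
by case: ifP => _; [exact: addrC | exact: add0r].
Qed.

Lemma card_sgraph (V : finType) : #|{: sgraph V}| = (2 ^ #|edges V|)%N.
Proof.
have : \sum_(G : sgraph V) 1 = \prod_(e in edges V) (1 + 1) :> int.
  rewrite -sum_graphs_prod; apply: eq_bigr => G _.
  by rewrite big1 // => e _; rewrite if_same.
rewrite sumr_const prodr_const -(natrD _ 1 1) -natrX => /eqP.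
by rewrite eqr_nat => /eqP.
Qed.

Lemma sum_prim_root (K : fieldType) (q : nat) (w : K) (a : nat) :
  q.-primitive_root w -> \sum_(s < q) w ^+ (s * a) = if (q %| a)%N then q%:R else 0.
Proof.
move=> wq; under eq_bigr do rewrite mulnC exprM.
case: ifP => qa.
  have /eqP -> : w ^+ a == 1 by rewrite -(prim_order_dvd wq).
  by rewrite (eq_bigr (fun=> 1)) ?sumr_const ?card_ord // => i _; rewrite expr1n.
have wa : w ^+ a - 1 != 0 by rewrite subr_eq0 -(prim_order_dvd wq) qa.
by apply: (mulfI wa); rewrite -subrX1 -exprM mulnC exprM (prim_expr_order wq) expr1n subrr mulr0.
Qed.

(** Double counting of the pairs of an edge of G[S] and an endpoint. It moves the phases from the
    vertices, which carry the degree conditions, to the edges, which vary independently. *)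
Lemma sum_deg_edges (V : finType) (G : sgraph V) (S : {set V}) (y : V -> nat) :
  (\sum_(v in S) y v * induced_deg G S v =
   \sum_(e in edges V | (e \in val G) && (e \subset S)) \sum_(v in e) y v)%N.
Proof.
transitivity (\sum_(v in S) \sum_(e in edges V | [&& e \in val G, e \subset S & v \in e]) y v)%N.
  apply: eq_bigr => v vS; rewrite sum_nat_const mulnC; congr (_ * _)%N.
  rewrite /induced_deg -(@card_in_imset _ _ (fun u => [set v; u])).
    apply: eq_card => e; rewrite [RHS]unfold_in /= inE; apply/imsetP/andP.
      case=> u; rewrite inE /adj => /andP[uS vuG] ->.
      have -> : #|[set v; u]| == 2%N by move/forall_inP: (valP G); apply.
      rewrite vuG set21 andbT; split=> //=; apply/subsetP => t.
      by rewrite !inE => /orP[]/eqP->.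
    case=> /cards2P[s [t [st ->]]] /and3P[eG /subsetP eS].
    rewrite !inE => /orP[] /eqP vE; rewrite vE.
      by exists t => //; rewrite inE /adj eG eS ?set22.
    by exists s; rewrite ?inE /adj ?[[set t; s]]setUC ?eG ?eS ?set21.
  move=> s t; rewrite !inE /adj => /andP[_ sG] /andP[_ tG] E.
  have vs : v != s.
    have : #|[set v; s]| == 2%N by move/forall_inP: (valP G); apply.
    by rewrite cards2; case: (v != s).
  have : s \in [set v; t] by rewrite -E set22.
  by rewrite !inE eq_sym (negbTE vs) => /eqP.
rewrite (exchange_big_dep [pred e in edges V | (e \in val G) && (e \subset S)]) /=; last first.
  by move=> v e _ /and4P[-> -> -> _].
apply: eq_bigr => e /and3P[eE eG eS]; apply: eq_bigl => v.
by rewrite eE eG eS /= andb_idl // => /(subsetP eS).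
Qed.

(** Orthogonality of characters at each vertex of S. Frequencies live on all of V so that their type
    does not depend on S; the free coordinates outside S are why the factor is q^|V|. *)
Lemma deg_cancels_fourier (K : numFieldType) (V : finType) (q : nat) (w : K)
    (wq : q.-primitive_root w) (G : sgraph V) (S : {set V}) (a : V -> nat) :
  (deg_cancels q G S a)%:R * q%:R ^+ #|V| =
  \sum_(x : {ffun V -> 'I_q}) w ^+ (\sum_(v in S) x v * a v)%N *
     \prod_(e in edges V) (if e \in val G then (if e \subset S then w ^+ edge_sum x e else 1) else 1).
Proof.
have q0 := prim_order_gt0 wq.
transitivity (\prod_v \sum_(s < q) (if v \in S then w ^+ (s * (induced_deg G S v + a v)) else 1)).
  case: (boolP (deg_cancels q G S a)) => [/forall_inP H|].
    rewrite mul1r -prodr_const; apply: eq_big => // v _.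
    have [vS|vS] := boolP (v \in S); first by rewrite sum_prim_root ?H.
    by rewrite sumr_const card_ord.
  rewrite negb_forall_in => /exists_inP[v vS H]; rewrite mul0r.
  by rewrite (bigD1 v) //= vS sum_prim_root // (negbTE H) mul0r.
rewrite bigA_distr_bigA; apply: eq_bigr => x _.
rewrite -big_mkcond /= prodrXr.
rewrite (eq_bigr (fun v => x v * a v + x v * induced_deg G S v)%N); last first.
  by move=> v _; rewrite addnC mulnDr.
rewrite big_split /= exprD; congr (_ * _).
rewrite sum_deg_edges -prodrXr [LHS]big_mkcondr; apply: eq_bigr => e _.
by case: (e \in val G); case: (e \subset S).
Qed.

(* The edges e of S, outside S', whose Fourier factor (1 + w^(x_u + x_v)) / 2 has
   modulus less than 1. *)
Definition damped_edges (V : finType) (q : nat) (S S' : {set V}) (x : {ffun V -> 'I_q}) :=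
  [set e in edges V | [&& e \subset S, ~~ (e \subset S') & ~~ (q %| edge_sum x e)%N]].

Definition character_bound (K : pzRingType) (V : finType) (q : nat) (rho : K) (S S' : {set V}) : K :=
  \sum_(x : {ffun V -> 'I_q}) rho ^+ #|damped_edges S S' x|.

(* The frequencies with no damped edge: x constant on S, equal to 0 or q/2.  They
   give the main term; q/2 reflects that the degrees in S have an even sum. *)
Definition constant_even (V : finType) (q : nat) (S : {set V}) : {set {ffun V -> 'I_q}} :=
  [set x : {ffun V -> 'I_q} | [exists s : 'I_q, (q %| 2 * s)%N && [forall v in S, x v == s]]].

Lemma norm_prim_root (C : numFieldType) (q : nat) (w : C) (a : nat) :
  q.-primitive_root w -> `|w ^+ a| = 1.
Proof.
move=> wq; suff E : `|w| = 1 by rewrite normrX E expr1n.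
apply/eqP; rewrite -(@pexpr_eq1 _ `|w| q) ?(prim_order_gt0 wq) //.
by rewrite -normrX (prim_expr_order wq) normr1.
Qed.

(** Parallelogram law: |1 + z|^2 + |1 - z|^2 = 4 on the unit circle. *)
Lemma norm_one_add_lt (C : numClosedFieldType) (z : C) :
  `|z| = 1 -> z != 1 -> `|1 + z| < 2.
Proof.
move=> z1 zn1; rewrite -(@ltr_pXn2r _ 2) ?nnegrE //.
have zz : z * z^* = 1 by rewrite -normCK z1 expr1n.
have: 0 < `|1 - z| ^+ 2 by rewrite exprn_gt0 // normr_gt0 subr_eq0 eq_sym.
rewrite !normCK !rmorphD rmorphN !rmorph1 -subr_gt0 => h.
rewrite (_ : 2 ^+ 2 - _ = (1 - z) * (1 - z^* ) + 2 * (1 - z * z^* )); last by ring.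
by rewrite zz subrr mulr0 addr0.
Qed.

(* The gap is rational so that bounds over algC transfer to every numFieldType. *)
Lemma prim_root_gap (q : nat) (w : algC) : q.-primitive_root w ->
  exists2 rho : rat, 0 < rho < 1 & forall a, ~~ (q %| a)%N -> `|1 + w ^+ a| <= 2 * ratr rho.
Proof.
move=> wq; have q0 := prim_order_gt0 wq.
pose gap (s : nat) : algC := 2 - `|1 + w ^+ s|.
(* The sum dominates each of its terms, so 1/N lies below every positive gap, and rho is chosen with
   2 rho = 2 - 1/N. *)
pose N := (\sum_(s < q) Num.bound (gap s)^-1)%N.+1.
have N0 : (0 : rat) < N%:R by rewrite ltr0n.
exists (1 - (2 * N%:R)^-1).
  rewrite ltrBlDr ltrDl invr_gt0 mulr_gt0 // andbT subr_gt0 invf_lt1 ?mulr_gt0 //.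
  by rewrite -(natrM _ 2) ltr1n; lia.
move=> a qa; set s := Ordinal (ltn_pmod a q0).
have wE : w ^+ a = w ^+ s by rewrite -(prim_expr_mod wq).
have g0 : 0 < gap s.
  rewrite subr_gt0; apply: norm_one_add_lt; first exact: norm_prim_root wq.
  by rewrite -wE -(prim_order_dvd wq).
have gN : gap s >= N%:R^-1.
  rewrite -[leRHS]invrK lef_pV2 ?posrE ?invr_gt0 ?ltr0n //.
  apply: le_trans (ltW (archi_boundP _)) _; first by rewrite invr_ge0 ltW.
  by rewrite ler_nat; apply: leqW; rewrite (bigD1 s) //= leq_addr.
rewrite wE rmorphB rmorph1 fmorphV rmorphM !rmorph_nat invfM mulrBr mulr1 mulrA divff ?pnatr_eq0 // mul1r.
by rewrite lerBrDr -lerBrDl.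
Qed.

Section CharacterSums.

Variables (V : finType) (q : nat) (w : algC) (rho : algC).
Hypotheses (wq : q.-primitive_root w)
  (rho_gap : forall a, ~~ (q %| a)%N -> `|1 + w ^+ a| <= 2 * rho).

Let norm_le2 a : `|1 + w ^+ a| <= 2.
Proof. by rewrite (le_trans (ler_normD _ _)) // normr1 (norm_prim_root _ wq). Qed.

Let phase (S : {set V}) (x : {ffun V -> 'I_q}) (e : {set V}) : algC :=
  if e \subset S then w ^+ edge_sum x e else 1.

Let norm_phase (S : {set V}) (x : {ffun V -> 'I_q}) (e : {set V}) : `|phase S x e| = 1.
Proof. by rewrite /phase; case: ifP; rewrite ?normr1 // (norm_prim_root _ wq). Qed.

Let phase_gap (S S' : {set V}) x e : e \in damped_edges S S' x -> `|1 + phase S x e| <= 2 * rho.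
Proof. by rewrite inE /phase => /and4P[_ -> _ /rho_gap]. Qed.

(** A damped edge lies in only one of the two sets, so the other phase is 1 and the gap applies. All
    other edges get the trivial bound 2. *)
Lemma prod_phases_le (S S' : {set V}) (x y : {ffun V -> 'I_q}) :
  \prod_(e in edges V) `|1 + phase S x e * phase S' y e| <=
  2 ^+ #|edges V| * (rho ^+ #|damped_edges S S' x| * rho ^+ #|damped_edges S' S y|).
Proof.
have E (A B : {set V}) (z : {ffun V -> 'I_q}) : rho ^+ #|damped_edges A B z| =
    \prod_(e in edges V) (if e \in damped_edges A B z then rho else 1).
  rewrite -prodr_const big_mkcond [RHS]big_mkcond; apply: eq_bigr => e _.
  by rewrite inE; case: (e \in edges V).
rewrite !E -prodr_const -!big_split /=; apply: ler_prod => e _; rewrite normr_ge0 /=.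
case: ifP => ex.
  have eS' : ~~ (e \subset S') by move: ex; rewrite inE => /and4P[].
  rewrite [X in _ * X](_ : _ = 1) ?mulr1; last by rewrite /phase (negbTE eS').
  by rewrite [X in _ * (_ * X)]ifF ?mulr1 ?(phase_gap ex) // inE (negbTE eS') andbF.
case: ifP => ey.
  have eS : ~~ (e \subset S) by move: ey; rewrite inE => /and4P[].
  rewrite {1}/phase (negbTE eS) !mul1r; exact: phase_gap ey.
by rewrite !mulr1 (le_trans (ler_normD _ _)) // normr1 normrM !norm_phase mulr1.
Qed.

(** The sum over graphs is carried out before absolute values are taken, so that it becomes a
    product over edges; the bound on that product then separates x from y. *)
Lemma joint_count_le (S S' : {set V}) (a a' : V -> nat) :
  #|[set G : sgraph V | deg_cancels q G S a && deg_cancels q G S' a']|%:R *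
     (q%:R ^+ #|V| * q%:R ^+ #|V|) <=
  2 ^+ #|edges V| * (character_bound q rho S S' * character_bound q rho S' S).
Proof.
pose A (S : {set V}) (a : V -> nat) (x : {ffun V -> 'I_q}) := w ^+ (\sum_(v in S) x v * a v)%N.
set lhs := (X in X <= _).
have lhs0 : 0 <= lhs by rewrite !mulr_ge0 ?exprn_ge0.
rewrite -(ger0_norm lhs0) {lhs0}.
have -> : lhs = \sum_(x : {ffun V -> 'I_q}) \sum_(y : {ffun V -> 'I_q}) A S a x * A S' a' y *
     \prod_(e in edges V) (1 + phase S x e * phase S' y e).
  rewrite /lhs cardsE -sum1_card natr_sum mulr_suml big_mkcond /=.
  transitivity (\sum_(G : sgraph V) \sum_(x : {ffun V -> 'I_q}) \sum_(y : {ffun V -> 'I_q})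
     (A S a x * \prod_(e in edges V) (if e \in val G then phase S x e else 1)) *
     (A S' a' y * \prod_(e in edges V) (if e \in val G then phase S' y e else 1))).
    apply: eq_bigr => G _.
    rewrite -big_distrlr /= -(deg_cancels_fourier wq) -(deg_cancels_fourier wq) unfold_in.
    by case: deg_cancels; case: deg_cancels; rewrite /= ?mul1r ?mul0r ?mulr0.
  rewrite exchange_big; apply: eq_bigr => x _; rewrite exchange_big; apply: eq_bigr => y _.
  rewrite -sum_graphs_prod mulr_sumr; apply: eq_bigr => G _.
  rewrite mulrACA -big_split; congr (_ * _); apply: eq_bigr => e _ /=.
  by case: ifP; rewrite ?mul1r.
rewrite mulr_suml mulr_sumr (le_trans (ler_norm_sum _ _ _)) //; apply: ler_sum => x _.
rewrite mulr_sumr mulr_sumr (le_trans (ler_norm_sum _ _ _)) //; apply: ler_sum => y _.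
rewrite normrM normrM !(norm_prim_root _ wq) !mul1r normr_prod.
exact: prod_phases_le.
Qed.

Lemma damped_constant_even (S S' : {set V}) x :
  x \in constant_even q S -> damped_edges S S' x = finset.set0.
Proof.
rewrite inE => /existsP[s /andP[qs /forall_inP xs]]; apply/setP => e; rewrite !inE.
apply/negbTE/negP => /and4P[/eqP e2 /subsetP eS _ /negP]; apply.
rewrite /edge_sum (eq_bigr (fun=> s : nat)) => [|v /eS /xs/eqP-> //].
by rewrite sum_nat_const e2.
Qed.

(** Up to the factor 2^|edges|, each frequency in [constant_even] contributes exactly 1: its edge
    phases are 1, and so is its vertex factor, since q divides 2s and the sum of a is even. The
    others contribute at most [character_bound] minus the number c of these in modulus, which leaves
    2c - [character_bound]. *)
Lemma count_ge (S : {set V}) (a : V -> nat) : (2 %| \sum_(v in S) a v)%N ->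
  2 ^+ #|edges V| * (2 * #|constant_even q S|%:R - character_bound q rho S finset.set0) <=
  #|[set G : sgraph V | deg_cancels q G S a]|%:R * q%:R ^+ #|V|.
Proof.
move=> a2; pose T (x : {ffun V -> 'I_q}) :=
  w ^+ (\sum_(v in S) x v * a v)%N * \prod_(e in edges V) (1 + phase S x e).
have E : #|[set G : sgraph V | deg_cancels q G S a]|%:R * q%:R ^+ #|V| =
    \sum_(x : {ffun V -> 'I_q}) T x.
  rewrite -sum1dep_card natr_sum mulr_suml big_mkcond /=.
  transitivity (\sum_(G : sgraph V) \sum_(x : {ffun V -> 'I_q})
     w ^+ (\sum_(v in S) x v * a v)%N * \prod_(e in edges V) (if e \in val G then phase S x e else 1)).
    apply: eq_bigr => G _; rewrite -(deg_cancels_fourier wq).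
    by case: deg_cancels; rewrite /= ?mul1r ?mul0r.
  rewrite exchange_big; apply: eq_bigr => x _; rewrite -mulr_sumr.
  by rewrite sum_graphs_prod.
rewrite (bigID (mem (constant_even q S))) /= in E.
have Ec : \sum_(x in constant_even q S) T x = 2 ^+ #|edges V| * #|constant_even q S|%:R.
  rewrite mulr_natr -sumr_const; apply: eq_bigr => x xc.
  move: (xc); rewrite inE => /existsP[s /andP[qs /forall_inP xs]].
  rewrite /T (eq_bigr (fun v => s * a v)%N) => [|v /xs/eqP-> //].
  rewrite -big_distrr /=; case/dvdnP: a2 => c ->.
  have /eqP -> : w ^+ (s * (c * 2)) == 1.
    by rewrite -(prim_order_dvd wq) mulnCA mulnC [(s * 2)%N]mulnC dvdn_mulr.
  rewrite mul1r -prodr_const; apply: eq_bigr => e ee.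
  rewrite /phase; case: ifP => // eS.
  suff /eqP -> : w ^+ edge_sum x e == 1 by [].
  rewrite -(prim_order_dvd wq); move/setP: (damped_constant_even finset.set0 xc) => /(_ e).
  rewrite !inE eS subset0; move: ee; rewrite inE => e2; rewrite e2 /=.
  by rewrite -cards_eq0 (eqP e2) /= => /negbFE.
rewrite {}Ec in E; set c := #|constant_even q S|; set B := (X in _ = _ + X) in E.
(* The order on [algC] is partial: a bound on the modulus of B bounds B from below only once B is
   known to be real. *)
have B_real : B \is Num.real.
  have -> : B = #|[set G : sgraph V | deg_cancels q G S a]|%:R * q%:R ^+ #|V| - 2 ^+ #|edges V| * c%:R.
    by rewrite E addrAC subrr add0r.
  by rewrite rpredB // rpredM ?rpredX ?realn.
have : `|B| <= 2 ^+ #|edges V| * (character_bound q rho S finset.set0 - c%:R).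
  rewrite /character_bound (bigID (mem (constant_even q S))) /=.
  rewrite (eq_bigr (fun=> 1)) => [|x xc]; last first.
    by rewrite damped_constant_even // cards0 expr0.
  rewrite sumr_const addrAC subrr add0r mulr_sumr (le_trans (ler_norm_sum _ _ _)) //.
  apply: ler_sum => x _; rewrite normrM (norm_prim_root _ wq) mul1r normr_prod.
  have := prod_phases_le S finset.set0 x x.
  rewrite [X in _ <= _ * (_ * X) -> _](_ : _ = 1).
    rewrite mulr1; apply: le_trans; rewrite le_eqVlt; apply/orP; left; apply/eqP.
    apply: eq_bigr => e; rewrite inE => /eqP e2; congr (`| _ |); congr (_ + _).
    by rewrite [phase finset.set0 _ _]/phase subset0 -cards_eq0 e2 mulr1.
  rewrite (_ : damped_edges _ _ _ = finset.set0) ?cards0 //.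
  apply/setP => e; rewrite !inE subset0 -cards_eq0.
  by case: eqP => // ->.
move=> /(real_lerNnormlW B_real) h; rewrite E -lerBlDl (le_trans _ h) // le_eqVlt.
apply/orP; left; apply/eqP.
by move: (2 ^+ _) c%:R (character_bound _ _ _ _) => u1 u2 u3; ring.
Qed.

End CharacterSums.

Lemma rmorph_character_bound (K L : pzRingType) (f : {rmorphism K -> L}) (V : finType) (q : nat) (rho : K)
    (S S' : {set V}) :
  f (character_bound q rho S S') = character_bound q (f rho) S S'.
Proof. by rewrite rmorph_sum; apply: eq_bigr => x _; rewrite rmorphXn. Qed.

(** The estimates hold in [algC], but rho is rational and everything else is an integer, so they
    descend to the rationals and pass from there to F. *)
Lemma residue_count_bounds (F : numFieldType) (q : nat) : (0 < q)%N ->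
  exists2 rho : F, 0 < rho < 1 & forall (V : finType) (S : {set V}) (a : V -> nat),
    [/\ forall S' a', #|[set G : sgraph V | deg_cancels q G S a && deg_cancels q G S' a']|%:R *
          (q%:R ^+ #|V| * q%:R ^+ #|V|) <=
          2 ^+ #|edges V| * (character_bound q rho S S' * character_bound q rho S' S) &
        (2 %| \sum_(v in S) a v)%N ->
          2 ^+ #|edges V| * (2 * #|constant_even q S|%:R - character_bound q rho S finset.set0) <=
          #|[set G : sgraph V | deg_cancels q G S a]|%:R * q%:R ^+ #|V|].
Proof.
move=> /C_prim_root_exists[w wq]; have [rho rho01 gap] := prim_root_gap wq.
exists (ratr rho); first by rewrite ltr0q -(rmorph1 (@ratr F)) ltr_rat.
move=> V S a; pose simp := (rmorphM, rmorphB, rmorphXn, rmorph_nat, rmorph_character_bound).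
split=> [S' a'|a2].
  have := joint_count_le wq gap S S' a a'; set N := #|_|.
  have := ler_rat F (N%:R * (q%:R ^+ #|V| * q%:R ^+ #|V|))
    (2 ^+ #|edges V| * (character_bound q rho S S' * character_bound q rho S' S)).
  by rewrite !simp /= => ->; rewrite -(ler_rat algC) !simp.
have := count_ge wq gap a2; set E := #|edges V|; set N := #|[set G | deg_cancels q G S a]|.
have := ler_rat F (2 ^+ E * (2 * #|constant_even q S|%:R - character_bound q rho S finset.set0))
  (N%:R * q%:R ^+ #|V|).
by rewrite !simp /= => ->; rewrite -(ler_rat algC) !simp.
Qed.

(** * Bounds on the character sums *)

Section CharacterBound.

Variables (F : realFieldType) (V : finType) (q : nat) (rho : F).
Hypotheses (q_gt0 : (0 < q)%N) (rho_ge0 : 0 <= rho) (rho_le1 : rho <= 1).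

Let value_class (S : {set V}) (x : {ffun V -> 'I_q}) (s : 'I_q) := [set v in S | x v == s].

(* The most frequent value s of x on S minus S' damps many edges: those inside its
   class if 2s is nonzero mod q, those leaving it otherwise. *)
Let popular_value (S : {set V}) (x : {ffun V -> 'I_q}) :
  exists s, (#|S| %/ q <= #|value_class S x s|)%N.
Proof.
apply/existsP; rewrite -[X in is_true X]negbK negb_exists; apply/negP => /forallP h.
have [b0|b_gt0] := posnP (#|S| %/ q).
  by have := h (Ordinal q_gt0); rewrite b0.
have: (\sum_(s < q) #|value_class S x s| <= \sum_(s < q) (#|S| %/ q).-1)%N.
  by apply: leq_sum => s _; have := h s; rewrite -ltnNge -{1}(prednK b_gt0) ltnS.
rewrite sum_nat_const card_ord (eq_bigr (fun s => \sum_(v in S | x v == s) 1)%N); last first.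
  by move=> s _; rewrite sum1dep_card.
rewrite -(partition_big x predT) //= sum1_card.
apply/negP; rewrite -ltnNge mulnC (leq_trans _ (leq_trunc_div #|S| q)) //.
by rewrite ltn_pmul2r // ltn_predL.
Qed.

Lemma damped_ge_pairs (S S' : {set V}) (x : {ffun V -> 'I_q}) (s : 'I_q) : ~~ (q %| 2 * s)%N ->
  ('C(#|value_class (S :\: S') x s|, 2) <= #|damped_edges S S' x|)%N.
Proof.
move=> qs; rewrite -cards_draws; apply: subset_leq_card; apply/subsetP => e.
rewrite !inE => /andP[/subsetP eN /eqP e2]; rewrite e2 eqxx /=.
have [v ve] : exists v, v \in e by apply/card_gt0P; rewrite e2.
apply/and3P; split.
- by apply/subsetP => u /eN; rewrite !inE => /andP[/andP[]].
- by apply/subsetPn; exists v => //; move: (eN v ve); rewrite !inE => /andP[/andP[]].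
rewrite /edge_sum (eq_bigr (fun=> s : nat)) => [|u /eN]; last by rewrite !inE => /andP[_ /eqP->].
by rewrite sum_nat_const e2.
Qed.

(** If x_u = s and 2s = 0, then x_u + x_v is nonzero as soon as x_v differs from s. Only u has to
    avoid S'; v ranges over all of S, so deviations from s are penalised on S and not just on S
    minus S'. *)
Lemma damped_ge_prod (S S' : {set V}) (x : {ffun V -> 'I_q}) (s : 'I_q) : (q %| 2 * s)%N ->
  (#|value_class (S :\: S') x s| * #|[set v in S | x v != s]| <= #|damped_edges S S' x|)%N.
Proof.
move=> qs; rewrite -cardsX -(@card_in_imset _ _ (fun p => [set p.1; p.2])).
  apply: subset_leq_card; apply/subsetP => e /imsetP[[u v]].
  rewrite !inE /= => /and3P[/andP[/andP[uS' uS] /eqP xu] vS xv] ->.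
  have uv : u != v by apply: contraNneq xv => <-; rewrite xu.
  rewrite cards2 uv /=; apply/and3P; split.
  - by apply/subsetP => t; rewrite !inE => /orP[] /eqP->.
  - by apply/subsetPn; exists u; rewrite // set21.
  rewrite /edge_sum big_setU1 ?inE //= big_set1 xu; apply: contraNN xv => qsv.
  have : (s + x v == s + s %[mod q])%N.
    by rewrite addnn -mul2n; move: qs qsv; rewrite /dvdn => /eqP-> /eqP->.
  by rewrite eqn_modDl !modn_small.
move=> [u v] [u' v']; rewrite !inE /=.
move=> /and3P[/andP[/andP[uS' uS] /eqP xu] vS xv] /and3P[/andP[/andP[_ _] /eqP xu'] _ xv'] E.
have uE : u = u'.
  have : u \in [set u'; v'] by rewrite -E set21.
  by rewrite !inE => /orP[/eqP //|/eqP uv']; rewrite -uv' xu eqxx in xv'.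
have : v \in [set u'; v'] by rewrite -E set22.
by rewrite !inE => /orP[/eqP vu|/eqP -> //]; [rewrite vu xu' eqxx in xv | rewrite uE].
Qed.

(** This is gcd(2, q) for positive q: the bounded factor left by the surviving constant
    frequencies. *)
Definition even_residues : nat := #|[set s : 'I_q | (q %| 2 * s)%N]|.

(** Union bound over the popular value s. If 2s = 0, each vertex of S where x differs from s costs
    rho^b, and the sum over x factorises: 1 + (q - 1) rho^b for a vertex of S, q for any other. If
    2s is nonzero, all q^|V| frequencies get the one factor rho^C(b, 2). *)
Lemma character_bound_le (S S' : {set V}) (b := (#|S :\: S'| %/ q)%N) :
  character_bound q rho S S' <=
  q%:R ^+ (#|V| - #|S|) * (even_residues%:R * (1 + q%:R * rho ^+ b) ^+ #|S|)
  + q%:R ^+ #|V| * rho ^+ 'C(b, 2).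
Proof.
pose g (s : 'I_q) (x : {ffun V -> 'I_q}) : F :=
  \prod_v (if (v \in S) && (x v != s) then rho ^+ b else 1).
have rb : 0 <= rho ^+ b by rewrite exprn_ge0.
have g0 s x : 0 <= g s x by apply: prodr_ge0 => v _; case: ifP.
have gE s x : g s x = (rho ^+ b) ^+ #|[set v in S | x v != s]|.
  rewrite /g -big_mkcond prodr_const; congr (_ ^+ _).
  by apply: eq_card => v; rewrite inE.
have pw (x : {ffun V -> 'I_q}) : rho ^+ #|damped_edges S S' x| <=
    (\sum_(s : 'I_q | (q %| 2 * s)%N) g s x) + rho ^+ 'C(b, 2).
  have [s bs] := popular_value (S :\: S') x.
  case: (boolP (q %| 2 * s)%N) => qs.
    rewrite (bigD1 s) //= -addrA -[leLHS]addr0 lerD //; last first.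
      by rewrite addr_ge0 ?exprn_ge0 // sumr_ge0.
    rewrite gE -exprM; apply: ler_wiXn2l => //.
    by rewrite (leq_trans _ (damped_ge_prod S S' x qs)) // leq_mul2r bs orbT.
  rewrite -[leLHS]add0r lerD ?sumr_ge0 //; apply: ler_wiXn2l => //.
  by rewrite (leq_trans _ (damped_ge_pairs S S' x qs)) // leq_bin2l.
have sg s : \sum_(x : {ffun V -> 'I_q}) g s x = q%:R ^+ (#|V| - #|S|) * (1 + q.-1%:R * rho ^+ b) ^+ #|S|.
  rewrite /g -(bigA_distr_bigA (fun v (t : 'I_q) => if (v \in S) && (t != s) then rho ^+ b else 1)).
  rewrite (bigID (mem S)) /= mulrC; congr (_ * _).
    rewrite (eq_bigr (fun=> q%:R)) => [|v /negbTE vS].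
      rewrite prodr_const; congr (_ ^+ _).
      by rewrite -(cardC (mem S)) addKn; apply: eq_card => v; rewrite !inE.
    by under eq_bigr do rewrite vS /=; rewrite sumr_const card_ord.
  rewrite -prodr_const; apply: eq_bigr => v vS.
  rewrite (bigD1 s) //= vS eqxx /=; congr (_ + _).
  rewrite (eq_bigr (fun=> rho ^+ b)) => [|t -> //].
  by rewrite sumr_const cardC1 card_ord mulr_natl.
apply: (le_trans (ler_sum _ (fun x _ => pw x))).
rewrite big_split /= exchange_big /= (eq_bigr _ (fun s _ => sg s)) sumr_const lerD //; last first.
  by rewrite sumr_const card_ffun card_ord -[leLHS]mulr_natl natrX.
rewrite -[leLHS]mulr_natl mulrCA ler_wpM2l ?exprn_ge0 // /even_residues cardsE ler_wpM2l //.
rewrite lerXn2r ?nnegrE ?addr_ge0 ?mulr_ge0 // lerD2l ler_wpM2r // ler_nat; exact: leq_pred.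
Qed.

End CharacterBound.

(** A vertex of S reveals the constant s, so the classes for different s are disjoint; for this S
    must be nonempty. *)
Lemma card_constant_even (V : finType) (q : nat) (S : {set V}) : S != finset.set0 ->
  #|constant_even q S| = (even_residues q * q ^ (#|V| - #|S|))%N.
Proof.
move=> /set0Pn[v0 v0S].
have cs (s : 'I_q) : #|[set x : {ffun V -> 'I_q} | [forall v in S, x v == s]]| = (q ^ (#|V| - #|S|))%N.
  rewrite cardsE.
  rewrite (eq_card (B := family (fun v => if v \in S then pred1 s else predT))).
    rewrite card_family foldrE big_map big_enum (bigID (mem S)) /=.
    rewrite big1 ?mul1n => [|v ->]; last by rewrite card1.
    rewrite (eq_bigr (fun=> q)) => [|v /negbTE->]; last by rewrite card_ord.
    rewrite prod_nat_const; congr (_ ^ _)%N.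
    by rewrite -(cardC (mem S)) addKn; apply: eq_card => v; rewrite !inE.
  move=> x; rewrite unfold_in; apply/forall_inP/familyP => h v.
    by case: ifP => // vS; apply: h.
  by move=> vS; have := h v; rewrite vS.
rewrite -sum1_card /even_residues -sum_nat_const.
rewrite (partition_big (fun x : {ffun V -> 'I_q} => x v0) (fun s => s \in [set s : 'I_q | (q %| 2 * s)%N])) /=.
  apply: eq_bigr => s; rewrite inE => qs; rewrite -(cs s) sum1dep_card.
  apply: eq_card => x; rewrite !inE; apply/andP/forall_inP.
    case=> /existsP[t /andP[_ /forall_inP xt]] /eqP <- v vS.
    by rewrite (eqP (xt v vS)) (eqP (xt v0 v0S)).
  move=> xs; split; last exact: xs.
  by apply/existsP; exists s; rewrite qs; apply/forall_inP.
by move=> x; rewrite !inE => /existsP[t /andP[qt /forall_inP /(_ v0 v0S)/eqP->]].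
Qed.

Lemma even_residues_gt0 (q : nat) : (0 < q)%N -> (0 < even_residues q)%N.
Proof. by move=> q0; apply/card_gt0P; exists (Ordinal q0); rewrite inE muln0 dvdn0. Qed.

(** * Counting prescribed degree profiles *)

Definition tuples_with_counts (q m : nat) (ks : 'I_q -> nat) : {set m.-tuple 'I_q} :=
  [set t : m.-tuple 'I_q | [forall i, count_mem i t == ks i]].

(** Induction on the length, by the first entry: the tuples starting with i account for (ks i) m!,
    and these terms add up to (m + 1) m!. *)
Lemma card_tuples_with_counts (q m : nat) (ks : 'I_q -> nat) : (\sum_i ks i)%N = m ->
  (#|tuples_with_counts m ks| * \prod_i (ks i)`!)%N = m`!.
Proof.
elim: m ks => [|m IH] ks sk.
  have k0 i : ks i = 0%N by apply/eqP; move/eqP: sk; rewrite sum_nat_eq0 => /forallP /(_ i).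
  rewrite big1 => [|i _]; last by rewrite k0.
  rewrite muln1 fact0 (_ : tuples_with_counts 0 ks = [set [tuple]]) ?cards1 //.
  apply/setP => t; rewrite !inE tuple0 eqxx; apply/forallP => i.
  by rewrite k0.
pose ks' (i j : 'I_q) := (ks j - (i == j))%N.
have fiber i : #|[set t in tuples_with_counts m.+1 ks | thead t == i]| =
    if (0 < ks i)%N then #|tuples_with_counts m (ks' i)| else 0%N.
  case: posnP => [ki0|ki].
    apply/eqP; rewrite cards_eq0; apply/eqP/setP => t; rewrite !inE; apply/negbTE/negP.
    case/andP => /forallP /(_ i); rewrite ki0 => /eqP c0 /eqP ti.
    by move: c0; rewrite (tuple_eta t) /= ti eqxx.
  rewrite -[RHS](@card_in_imset _ _ (fun t : m.-tuple 'I_q => [tuple of i :: t])); last first.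
    by move=> t t' _ _ /(congr1 val) [] /val_inj.
  apply: eq_card => t; rewrite !inE; apply/andP/imsetP.
    case=> /forallP ct /eqP ti; exists [tuple of behead t]; last first.
      by rewrite -ti; exact: tuple_eta.
    rewrite inE; apply/forallP => j; rewrite /ks' -(eqP (ct j)) (tuple_eta t) /= ti.
    by rewrite addKn.
  case=> t'; rewrite inE => /forallP ct ->; rewrite theadE eqxx; split=> //.
  apply/forallP => j /=; rewrite (eqP (ct j)) /ks'.
  by case: (i =P j) => [<-|_]; rewrite ?subnKC ?subn0.
rewrite -sum1_card (partition_big (fun t : m.+1.-tuple 'I_q => thead t) predT) //= big_distrl /=.
transitivity (\sum_i ks i * m`!)%N; last by rewrite -big_distrl /= sk factS.
apply: eq_bigr => i _; rewrite sum1dep_card fiber; case: posnP => [->|ki]; first by rewrite mul0n.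
have s' : (\sum_j ks' i j)%N = m.
  have E : (\sum_(j | j != i) ks' i j = \sum_(j | j != i) ks j)%N.
    by apply: eq_bigr => j /negbTE; rewrite /ks' eq_sym => ->; rewrite subn0.
  rewrite (bigD1 i) //= E; move: sk; rewrite (bigD1 i) //= /ks' eqxx subn1 => /eqP.
  by rewrite -{1}(prednK ki) addSn eqSS => /eqP.
rewrite -(IH _ s') mulnCA; congr (_ * _)%N.
rewrite (bigD1 i) //= [in RHS](bigD1 i) //= mulnA; congr (_ * _)%N.
  by rewrite /ks' eqxx subn1 -{1 2}(prednK ki) factS prednK.
by apply: eq_bigr => j /negbTE; rewrite /ks' eq_sym => ->; rewrite subn0.
Qed.

Section DegreeProfiles.

Variables (V : finType) (q : nat).

(* Turns the profile t, listed along [enum S], into the shift that [deg_cancels]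
   expects. *)
Definition shift_to (S : {set V}) (t : seq 'I_q) (v : V) : nat :=
  (q - nth 0%N (map val t) (index v (enum S)))%N.

Definition residues_eq (G : sgraph V) (S : {set V}) (ks : 'I_q -> nat) : bool :=
  [forall i : 'I_q, #|deg_class G q S i| == ks i].

Hypothesis q_gt0 : (0 < q)%N.

Let profile (G : sgraph V) (S : {set V}) : #|S|.-tuple 'I_q :=
  [tuple of map (fun v => Ordinal (ltn_pmod (induced_deg G S v) q_gt0)) (enum S)].

(** Exactly one tuple of residues fits G on S, so summing indicators over tuples with given counts
    counts each set at most once. *)
Lemma deg_cancels_shift (G : sgraph V) (S : {set V}) (t : #|S|.-tuple 'I_q) :
  deg_cancels q G S (shift_to S t) = (t == profile G S).
Proof.
have key (t' : #|S|.-tuple 'I_q) v : v \in S -> (q %| induced_deg G S v + shift_to S t' v)%N =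
    (induced_deg G S v %% q == nth 0%N (map val t') (index v (enum S)))%N.
  move=> vS; rewrite /shift_to; set r := nth _ _ _.
  have rq : (r < q)%N.
    rewrite /r (nth_map (Ordinal q_gt0)) ?size_tuple ?cardE ?index_mem ?mem_enum //; exact: ltn_ord.
  rewrite -[r in RHS](modn_small rq) -(eqn_modDr (q - r)) (subnKC (ltnW rq)) modnn.
  by rewrite /dvdn.
apply/forall_inP/eqP => [H|-> v vS]; last first.
  rewrite key // -map_comp (nth_map v) ?index_mem ?mem_enum //= nth_index ?mem_enum //.
apply: val_inj; apply: (inj_map val_inj); apply: (@eq_from_nth _ 0%N).
  by rewrite !size_map size_tuple -cardE.
move=> i; rewrite size_map size_tuple => iS.
have [v0 _] : exists v, v \in S by apply/card_gt0P; apply: leq_ltn_trans iS.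
have iS' : (i < size (enum S))%N by rewrite -cardE.
have vS : nth v0 (enum S) i \in S by rewrite -mem_enum mem_nth.
have := H _ vS; rewrite (key _ _ vS) (index_uniq _ iS' (enum_uniq _)) => /eqP <-.
by rewrite -map_comp (nth_map v0).
Qed.

Lemma count_profile (G : sgraph V) (S : {set V}) (i : 'I_q) :
  count_mem i (profile G S) = #|deg_class G q S i|.
Proof.
rewrite /= count_map -size_filter cardE; congr size.
rewrite /deg_class /enum_mem -enumT /= -filter_predI; apply: eq_filter => v.
rewrite !inE /= andbC; congr andb; rewrite -val_eqE /=.
by rewrite (modn_small (ltn_ord i)).
Qed.

End DegreeProfiles.

(** * First and second moments *)

(** At edge probability 1/2 all graphs are equally likely, so probabilities are ratios of
    cardinals. *)
Definition gprob (R : realFieldType) (V : finType) (A : pred (sgraph V)) : R :=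
  #|[set G | A G]|%:R / #|{: sgraph V}|%:R.

(* Bounds q^m times the probability of a degree profile on m vertices, given all
   edges that avoid some a of them. *)
Definition residue_bound (R : realFieldType) (q : nat) (rho : R) (m a : nat) : R :=
  (even_residues q)%:R * (1 + q%:R * rho ^+ (a %/ q)) ^+ m + q%:R ^+ m * rho ^+ 'C(a %/ q, 2).

Lemma sgraph_gt0 (R : realFieldType) (V : finType) : 0 < #|{: sgraph V}|%:R :> R.
Proof. by rewrite ltr0n card_sgraph expn_gt0. Qed.

Lemma gprob_sum (R : realFieldType) (V : finType) (A : pred (sgraph V)) :
  gprob R A = (\sum_(G : sgraph V) (A G)%:R) / #|{: sgraph V}|%:R.
Proof.
rewrite /gprob -sum1dep_card natr_sum big_mkcond /=; congr (_ / _).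
by apply: eq_bigr => G _; case: (A G).
Qed.

Lemma gprob_ge0 (R : realFieldType) (V : finType) (A : pred (sgraph V)) : 0 <= gprob R A.
Proof. by rewrite divr_ge0. Qed.

Lemma gprob_le (R : realFieldType) (V : finType) (A B : pred (sgraph V)) :
  (forall G, A G -> B G) -> gprob R A <= gprob R B.
Proof.
move=> AB; rewrite ler_wpM2r ?invr_ge0 // ler_nat; apply: subset_leq_card.
by apply/subsetP => G; rewrite !inE; exact: AB.
Qed.

Lemma gprob_setC (R : realFieldType) (V : finType) (A : pred (sgraph V)) :
  gprob R (fun G => ~~ A G) = 1 - gprob R A.
Proof.
apply/eqP; rewrite eq_sym subr_eq /gprob -mulrDl -natrD.
rewrite (_ : (_ + _)%N = #|{: sgraph V}|) ?divff ?lt0r_neq0 ?sgraph_gt0 //.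
by rewrite addnC -[RHS](cardsC [set G | A G]); congr addn; apply: eq_card => G; rewrite !inE.
Qed.

Lemma Gnp_prob_half (R : realType) (n : nat) (A : pred (sgraph 'I_n)) :
  Gnp_prob (1 / 2 : R) A = gprob R A.
Proof.
have E (G : sgraph 'I_n) : Gnp_mass (1 / 2 : R) G = #|{: sgraph 'I_n}|%:R^-1.
  rewrite /Gnp_mass card_sgraph natrX -exprVn -prodr_const.
  apply: eq_big => [e|e _]; first by rewrite inE.
  by case: ifP => _; lra.
by rewrite /Gnp_prob (eq_bigr _ (fun G _ => E G)) sumr_const /gprob cardsE -[LHS]mulr_natl //.
Qed.

Lemma residue_prob_bounds (R : realFieldType) (q : nat) : (0 < q)%N ->
  exists2 rho : R, 0 < rho < 1 & forall (V : finType) (S : {set V}) (a : V -> nat),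
    let tau := residue_bound q rho in
    [/\ forall S' a', gprob R (fun G => deg_cancels q G S a && deg_cancels q G S' a') <=
          q%:R ^- #|S| * q%:R ^- #|S'| * (tau #|S| #|S :\: S'| * tau #|S'| #|S' :\: S|),
        gprob R (fun G => deg_cancels q G S a) <= q%:R ^- #|S| * tau #|S| #|S| &
        (2 %| \sum_(v in S) a v)%N -> S != finset.set0 ->
          q%:R ^- #|S| * (2 * (even_residues q)%:R - tau #|S| #|S|) <=
          gprob R (fun G => deg_cancels q G S a)].
Proof.
move=> q0; have [rho rho01 H] := residue_count_bounds R q0; exists rho => // V S a tau.
have qn0 k : (0 : R) < q%:R ^+ k by rewrite exprn_gt0 // ltr0n.
have Z0 := sgraph_gt0 R V; have ZE : #|{: sgraph V}|%:R = 2 ^+ #|edges V| :> R by rewrite card_sgraph natrX.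
case/andP: rho01 => rho0 rho1.
have T (A B : {set V}) : character_bound q rho A B / q%:R ^+ #|V| <= q%:R ^- #|A| * tau #|A| #|A :\: B|.
  rewrite ler_pdivrMr // (le_trans (character_bound_le q0 (ltW rho0) (ltW rho1) A B)) //.
  rewrite le_eqVlt; apply/orP; left; apply/eqP; rewrite /tau /residue_bound.
  have -> : #|V| = (#|V| - #|A| + #|A|)%N by rewrite subnK // max_card.
  rewrite addnK exprD; field; exact: lt0r_neq0.
have T0 (A B : {set V}) : 0 <= character_bound q rho A B / q%:R ^+ #|V|.
  by rewrite divr_ge0 ?(ltW (qn0 _)) // sumr_ge0 // => x _; rewrite exprn_ge0 // ltW.
have [Hj He] := H V S a.
split=> [S' a'| |a2 S0].
- rewrite /gprob ler_pdivrMr //.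
  have {Hj} := Hj S' a'; rewrite -ler_pdivlMr ?mulr_gt0 // => /le_trans; apply.
  rewrite ZE [leRHS]mulrC -[leLHS]mulrA ler_wpM2l ?exprn_ge0 // invfM mulrACA [leRHS]mulrACA.
  by rewrite ler_pM.
(* The bound for one set is the joint bound with the empty set, whose degree condition is void and
   whose character sum is q^|V|. *)
- have {Hj} := Hj finset.set0 (fun=> 0%N).
  rewrite (_ : [set G | _] = [set G | deg_cancels q G S a]); last first.
    apply/setP => G; rewrite !inE andb_idr // => _.
    by apply/forall_inP => v; rewrite inE.
  rewrite -ler_pdivlMr ?mulr_gt0 // => h.
  rewrite /gprob ler_pdivrMr // (le_trans h) //.
  have -> : character_bound q rho finset.set0 S = q%:R ^+ #|V|.
    rewrite /character_bound (eq_bigr (fun=> 1)) => [|x _].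
      by rewrite sumr_const card_ffun card_ord natrX.
    rewrite (_ : damped_edges _ _ _ = finset.set0) ?cards0 //.
    by apply/setP => e; rewrite !inE subset0 -cards_eq0; case: eqP => // ->.
  rewrite ZE [leRHS]mulrC -[leLHS]mulrA ler_wpM2l ?exprn_ge0 // invfM mulrA mulfK ?lt0r_neq0 //.
  by have := T S finset.set0; rewrite setD0.
rewrite /gprob ler_pdivlMr //.
have {He} := He a2; rewrite -ler_pdivrMr // => /(le_trans _); apply.
rewrite mulrC ZE -[leRHS]mulrA ler_wpM2l ?exprn_ge0 //.
rewrite card_constant_even // natrM natrX mulrBr mulrBl; apply: lerB.
  rewrite le_eqVlt; apply/orP; left; apply/eqP.
  have -> : #|V| = (#|V| - #|S| + #|S|)%N by rewrite subnK // max_card.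
  rewrite addnK exprD; field; rewrite !lt0r_neq0 //.
by have := T S finset.set0; rewrite setD0.
Qed.

(** Chebyshev's inequality at distance mu: where X = 0 the squared deviation (X - mu)^2 equals
    mu^2. *)
Lemma paley_zygmund (R : realFieldType) (V : finType) (X : sgraph V -> nat)
    (mu := (\sum_G (X G)%:R) / #|{: sgraph V}|%:R : R) : 0 < mu ->
  gprob R (fun G => X G == 0%N) <=
    ((\sum_G (X G)%:R ^+ 2) / #|{: sgraph V}|%:R) / mu ^+ 2 - 1.
Proof.
move=> mu0; have Z0 := sgraph_gt0 R V; set Z := #|_|%:R in mu mu0 Z0 *.
have E : \sum_G (X G)%:R = mu * Z by rewrite /mu divfK ?lt0r_neq0.
suff h : gprob R (fun G => X G == 0%N) * Z * mu ^+ 2 <= \sum_G (X G)%:R ^+ 2 - mu ^+ 2 * Z.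
  rewrite lerBrDr ler_pdivlMr ?exprn_gt0 // ler_pdivlMr // mulrDl mul1r mulrDl mulrAC.
  by rewrite -lerBrDr.
rewrite gprob_sum -/Z divfK ?lt0r_neq0 // mulr_suml.
have -> : \sum_G (X G)%:R ^+ 2 - mu ^+ 2 * Z = \sum_G ((X G)%:R - mu) ^+ 2.
  rewrite [RHS](eq_bigr (fun G => (X G)%:R ^+ 2 + (- (2 * mu) * (X G)%:R + mu ^+ 2))); last by move=> G _; ring.
  rewrite big_split /= big_split /= -mulr_sumr E sumr_const -[mu ^+ 2 *+ _]mulr_natr -/Z; ring.
apply: ler_sum => G _; case: eqP => [->|_]; first by rewrite mul1r sub0r sqrrN.
by rewrite mul0r sqr_ge0.
Qed.

Section Moments.

Variables (R : realFieldType) (q : nat) (rho : R) (V : finType) (m : nat) (ks : 'I_q -> nat).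
Hypotheses (q_gt0 : (0 < q)%N).

Let tau := residue_bound q rho m.
Let C := tuples_with_counts m ks.
Let N : R := 'C(#|V|, m)%:R * #|C|%:R.

Definition residue_sets (G : sgraph V) : nat := #|[set S : {set V} | (#|S| == m) && residues_eq G S ks]|.

Hypothesis bounds : forall (S : {set V}) (a : V -> nat),
    let tau := residue_bound q rho in
    [/\ forall S' a', gprob R (fun G => deg_cancels q G S a && deg_cancels q G S' a') <=
          q%:R ^- #|S| * q%:R ^- #|S'| * (tau #|S| #|S :\: S'| * tau #|S'| #|S' :\: S|),
        gprob R (fun G => deg_cancels q G S a) <= q%:R ^- #|S| * tau #|S| #|S| &
        (2 %| \sum_(v in S) a v)%N -> S != finset.set0 ->
          q%:R ^- #|S| * (2 * (even_residues q)%:R - tau #|S| #|S|) <=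
          gprob R (fun G => deg_cancels q G S a)].

Lemma residues_eq_sum (G : sgraph V) (S : {set V}) : #|S| = m ->
  (residues_eq G S ks : nat) = (\sum_(t in C) deg_cancels q G S (shift_to S t))%N.
Proof.
rewrite /C; case: m / => /=; set p := [tuple of map (fun v => Ordinal (ltn_pmod (induced_deg G S v) q_gt0)) (enum S)].
rewrite (eq_bigr (fun t => (t == p) : nat)) => [|t _]; last by rewrite (deg_cancels_shift q_gt0).
rewrite big_mkcond (bigD1 p) //= eqxx big1 ?addn0 => [|t /negbTE ->]; last by rewrite if_same.
suff -> : residues_eq G S ks = (p \in tuples_with_counts #|S| ks) by case: (_ \in _).
by rewrite inE; apply: eq_forallb => i; rewrite (count_profile q_gt0).
Qed.

Lemma residue_sets_sum (G : sgraph V) :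
  residue_sets G = (\sum_(S : {set V} | #|S| == m) \sum_(t in C) deg_cancels q G S (shift_to S t))%N.
Proof.
rewrite /residue_sets -sum1dep_card big_mkcondr /=; apply: eq_bigr => S /eqP Sm.
by rewrite -residues_eq_sum //; case: residues_eq.
Qed.

Lemma mean_residue_sets :
  (\sum_G (residue_sets G)%:R) / #|{: sgraph V}|%:R =
  \sum_(S : {set V} | #|S| == m) \sum_(t in C) gprob R (fun G => deg_cancels q G S (shift_to S t)).
Proof.
rewrite (eq_bigr (fun G => \sum_(S : {set V} | #|S| == m) \sum_(t in C) (deg_cancels q G S (shift_to S t))%:R)).
  rewrite exchange_big /= mulr_suml; apply: eq_bigr => S _.
  rewrite exchange_big /= mulr_suml; apply: eq_bigr => t _.
  by rewrite gprob_sum.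
by move=> G _; rewrite residue_sets_sum natr_sum; apply: eq_bigr => S _; rewrite natr_sum.
Qed.

Lemma sum_sets_tuples (x : R) : \sum_(S : {set V} | #|S| == m) \sum_(t in C) x = N * x.
Proof.
rewrite !sumr_const -mulrnA /N -natrM mulr_natl; congr (_ *+ _).
have -> : 'C(#|V|, m) = #|[pred S : {set V} | #|S| == m]|.
  by rewrite -card_draws; apply: eq_card => S; rewrite !inE.
exact: mulnC.
Qed.

Lemma mean_residue_sets_le :
  (\sum_G (residue_sets G)%:R) / #|{: sgraph V}|%:R <= N * (q%:R ^- m * tau m).
Proof.
rewrite mean_residue_sets -sum_sets_tuples; apply: ler_sum => S /eqP Sm; apply: ler_sum => t _.
by have [_ + _] := bounds S (shift_to S t); rewrite Sm.
Qed.

Lemma gprob_residue_sets_le : gprob R (fun G => (0 < residue_sets G)%N) <= N * (q%:R ^- m * tau m).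
Proof.
rewrite (le_trans _ mean_residue_sets_le) // gprob_sum ler_wpM2r ?invr_ge0 //.
by apply: ler_sum => G _; rewrite ler_nat; case: (residue_sets G).
Qed.

Hypotheses (m_gt0 : (0 < m)%N) (ks_even : forall i, ~~ odd (ks i)).

(** The shifts of a profile add up to the sum of (ks i) (q - i), which even counts make even, as the
    lower bound for a single profile requires. *)
Lemma mean_residue_sets_ge :
  N * (q%:R ^- m * (2 * (even_residues q)%:R - tau m)) <=
  (\sum_G (residue_sets G)%:R) / #|{: sgraph V}|%:R.
Proof.
rewrite mean_residue_sets -sum_sets_tuples; apply: ler_sum => S /eqP Sm; apply: ler_sum => t tC.
have [_ _] := bounds S (shift_to S t); rewrite Sm; apply; last first.
  by rewrite -card_gt0 Sm.
have st : size (map val t) = size (enum S) by rewrite size_map size_tuple -cardE Sm.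
have -> : (\sum_(v in S) shift_to S t v = \sum_(r <- t) (q - r))%N.
  rewrite -big_enum /shift_to -[RHS](big_map val predT (fun r => (q - r)%N)).
  have {2}-> : map val t = map (fun v => nth 0%N (map val t) (index v (enum S))) (enum S).
    apply: (@eq_from_nth _ 0%N); rewrite ?size_map -?st ?size_map // => i it.
    have [v0 _] : exists v, v \in S.
      by apply/card_gt0P; rewrite cardE -st size_map; apply: leq_ltn_trans it.
    by rewrite [RHS](nth_map v0) -?st ?size_map // index_uniq ?enum_uniq -?st ?size_map.
  by rewrite big_map.
have -> : (\sum_(r <- t) (q - r) = \sum_(i < q) count_mem i t * (q - i))%N.
  rewrite (partition_big id predT) //=; apply: eq_bigr => i _.
  by rewrite (eq_bigr (fun=> q - i)%N) => [|r /eqP-> //]; rewrite big_const_seq iter_addn_0 mulnC.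
apply: dvdn_sum => i _; apply: dvdn_mulr; rewrite dvdn2.
by move: tC; rewrite inE => /forallP/(_ i)/eqP ->.
Qed.

Variables (a0 : nat) (B tau1 : R).
Hypotheses (tau_le : forall a, (a0 <= a <= m)%N -> tau a <= tau1) (rho_ge0 : 0 <= rho) (B_ge0 : 0 <= B)
  (near_le : forall S : {set V}, #|S| = m ->
    #|[set S' : {set V} | (#|S'| == m) && (#|S :\: S'| < a0)%N]|%:R <= B).

(** Sets at distance at least [a0] obey the joint bound with both factors at most [tau1], which
    gives the square. Closer sets may share too many edges for that, and only their number is
    used. *)
Lemma second_moment_le :
  (\sum_G (residue_sets G)%:R ^+ 2) / #|{: sgraph V}|%:R <=
  (N * (q%:R ^- m * tau1)) ^+ 2 + B * ((\sum_G (residue_sets G)%:R) / #|{: sgraph V}|%:R).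
Proof.
pose J (G : sgraph V) (S : {set V}) (t : m.-tuple 'I_q) : R := (deg_cancels q G S (shift_to S t))%:R.
pose near (S S' : {set V}) := (#|S :\: S'| < a0)%N.
have XE G : (residue_sets G)%:R = \sum_(S : {set V} | #|S| == m) \sum_(t in C) J G S t.
  by rewrite residue_sets_sum natr_sum; apply: eq_bigr => S _; rewrite natr_sum.
have near_sum G (S : {set V}) : #|S| = m -> \sum_(S' : {set V} | (#|S'| == m) && near S S') \sum_(t in C) J G S' t <= B.
  move=> Sm.
  rewrite (le_trans (y := \sum_(S' : {set V} | (#|S'| == m) && near S S') 1)) //.
    apply: ler_sum => S' /andP[/eqP S'm _]; rewrite -natr_sum -residues_eq_sum //.
    by case: residues_eq.
  by rewrite sumr_const (le_trans _ (near_le Sm)) // cardsE.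
have sqE G : (residue_sets G)%:R ^+ 2 <=
    \sum_(S : {set V} | #|S| == m) \sum_(t in C)
      \sum_(S' : {set V} | (#|S'| == m) && ~~ near S S') \sum_(t' in C) J G S t * J G S' t'
    + B * (residue_sets G)%:R.
  (* At most one profile t' per set S' is realised in G, so the pairs with S' near S
     contribute at most B times [residue_sets G]. *)
  rewrite expr2 {1 3}XE mulr_suml mulr_sumr -big_split /=; apply: ler_sum => S /eqP Sm.
  rewrite mulr_suml mulr_sumr -big_split /=; apply: ler_sum => t _.
  rewrite XE (bigID (near S)) /= mulrDr [leLHS]addrC lerD //.
    by rewrite mulr_sumr; apply: ler_sum => S' _; rewrite mulr_sumr.
  by rewrite mulrC ler_wpM2r // near_sum.
rewrite (le_trans (ler_wpM2r _ (ler_sum _ (fun G _ => sqE G)))) ?invr_ge0 //.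
rewrite big_split /= -mulr_sumr mulrDl -mulrA lerD2r.
rewrite exchange_big /= mulr_suml.
rewrite (_ : (_ ^+ 2) = N * (q%:R ^- m * tau1 * (N * (q%:R ^- m * tau1)))); last by ring.
rewrite -sum_sets_tuples; apply: ler_sum => S /eqP Sm.
rewrite exchange_big /= mulr_suml; apply: ler_sum => t _.
rewrite (_ : q%:R ^- m * tau1 * _ = N * (q%:R ^- m * q%:R ^- m * (tau1 * tau1))); last by ring.
rewrite -sum_sets_tuples exchange_big /= mulr_suml big_mkcondr /=.
have t0 a : 0 <= tau a.
  by rewrite addr_ge0 ?mulr_ge0 ?exprn_ge0 // addr_ge0 // mulr_ge0 // exprn_ge0.
apply: ler_sum => S' /eqP S'm; case: ifP => far; last first.
  apply: sumr_ge0 => t' _; apply: mulr_ge0; last by rewrite -expr2 sqr_ge0.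
  by rewrite mulr_ge0 ?invr_ge0 ?exprn_ge0.
rewrite exchange_big /= mulr_suml; apply: ler_sum => t' _.
have [+ _ _] := bounds S (shift_to S t) => /(_ S' (shift_to S' t')).
rewrite Sm S'm gprob_sum => h.
rewrite (le_trans (le_trans _ h)) //.
  by rewrite le_eqVlt; apply/orP; left; apply/eqP; congr (_ / _); apply: eq_bigr => G _; rewrite -mulnb natrM.
have cS : #|S' :\: S| = #|S :\: S'|.
  by apply/eqP; rewrite -(eqn_add2l #|S' :&: S|) cardsID setIC cardsID Sm S'm.
have Sf : (a0 <= #|S :\: S'| <= m)%N by rewrite -leqNgt in far; rewrite far -Sm subset_leq_card // subsetDl.
rewrite ler_wpM2l ?mulr_ge0 ?invr_ge0 ?exprn_ge0 // cS.
by rewrite ler_pM ?t0 //; apply: tau_le.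
Qed.

(** Divided by the squared mean, the far part loses N and leaves the ratio of the upper to the lower
    bound for one profile; the near part keeps one power of the mean in its denominator. *)
Lemma gprob_no_residue_sets (L := q%:R ^- m * (2 * (even_residues q)%:R - tau1)) :
  (a0 <= m)%N -> 0 < N -> tau1 < 2 * (even_residues q)%:R ->
  gprob R (fun G => residue_sets G == 0%N) <=
    (tau1 / (2 * (even_residues q)%:R - tau1)) ^+ 2 + B / (N * L) - 1.
Proof.
move=> a0m N0 tM; have qm : (0 : R) < q%:R ^- m by rewrite invr_gt0 exprn_gt0 // ltr0n.
have L0 : 0 < N * L by rewrite /L mulr_gt0 // mulr_gt0 // subr_gt0.
set mu := (\sum_G (residue_sets G)%:R) / #|{: sgraph V}|%:R : R.
have Lmu : N * L <= mu.
  apply: le_trans mean_residue_sets_ge; rewrite !ler_wpM2l // ?(ltW N0) ?(ltW qm) //.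
  by rewrite lerD2l lerN2 tau_le // a0m leqnn.
have mu0 : 0 < mu by apply: lt_le_trans Lmu.
apply: (le_trans (paley_zygmund mu0)); rewrite lerD2r -/mu.
rewrite (le_trans (ler_wpM2r _ second_moment_le)) ?invr_ge0 ?sqr_ge0 // mulrDl lerD //.
  have t10 : 0 <= tau1.
    apply: le_trans (tau_le (a := m) _); last by rewrite a0m leqnn.
    by rewrite addr_ge0 ?mulr_ge0 ?exprn_ge0 // addr_ge0 // mulr_ge0 // exprn_ge0.
  have D0 : 0 < 2 * (even_residues q)%:R - tau1 by rewrite subr_gt0.
  rewrite -expr_div_n lerXn2r ?nnegrE //.
  - by rewrite !mulr_ge0 ?invr_ge0 ?(ltW mu0) ?(ltW qm) ?(ltW N0).
  - by rewrite divr_ge0 ?(ltW D0).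
  rewrite (le_trans (y := N * (q%:R ^- m * tau1) / (N * L))) //.
    by rewrite ler_wpM2l ?lef_pV2 ?posrE // !mulr_ge0 ?(ltW qm) ?(ltW N0).
  have cancel2 (a b c d : R) : a != 0 -> b != 0 -> d != 0 -> a * (b * c) / (a * (b * d)) = c / d.
    by move=> a0' b0' d0'; field; rewrite a0' b0' d0'.
  by rewrite /L cancel2 ?lt0r_neq0.
rewrite -/mu (_ : B * mu / mu ^+ 2 = B / mu); last by field; exact: lt0r_neq0.
by rewrite ler_wpM2l // lef_pV2 ?posrE.
Qed.

End Moments.

(** * Entropy estimates *)

Section Entropy.

Variable R : realType.

Lemma mul_ln_subr_le (x y : R) : 0 < x -> 0 < y -> x * (ln y - ln x) <= y - x.
Proof.
move=> x0 y0; rewrite -ln_div ?posrE // mulrC -ler_pdivlMr //.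
have -> : y / x = 1 + (y - x) / x by field; exact: lt0r_neq0.
apply: le_ln1Dx; rewrite -subr_gt0 opprK.
have -> : (y - x) / x + 1 = y / x by field; exact: lt0r_neq0.
by rewrite divr_gt0.
Qed.

Lemma ln_fact_ge (j : nat) : j%:R * ln j%:R - j%:R <= ln j`!%:R :> R.
Proof.
elim: j => [|j IH]; first by rewrite fact0 ln1 mul0r subr0.
rewrite factS natrM lnM ?posrE ?ltr0n ?fact_gt0 //.
have [->|j0] := posnP j; first by rewrite fact0 !ln1; lra.
have := @mul_ln_subr_le j%:R j.+1%:R; rewrite !ltr0n => /(_ j0 isT).
move: IH; rewrite -natr1; lra.
Qed.

(** A crude Stirling bound. In the induction j (ln (j+1) - ln j) falls short of 1 by at most
    1/(j+1), and the increment of 2 ln (j+1), at least 2/(j+2), pays for it. *)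
Lemma ln_fact_le (j : nat) : ln j`!%:R <= j%:R * ln j%:R - j%:R + 2 * ln j.+1%:R + 1 :> R.
Proof.
elim: j => [|j IH]; first by rewrite fact0 !ln1; lra.
rewrite factS natrM lnM ?posrE ?ltr0n ?fact_gt0 //.
have [->|j0] := posnP j.
  by have : 0 <= ln (2%:R : R); [apply: ln_ge0; rewrite ler1n | rewrite fact0 !ln1; lra].
have c1 : (j.+1%:R : R)^-1 <= ln j.+1%:R - ln j%:R.
  have := @mul_ln_subr_le j.+1%:R j%:R; rewrite !ltr0n => /(_ isT j0).
  by rewrite -lerN2 -mulrN !opprB -natr1 addrAC subrr add0r mulrC -ler_pdivrMr ?natr1 ?ltr0n // mul1r.
have c2 : (j.+2%:R : R)^-1 <= ln j.+2%:R - ln j.+1%:R.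
  have := @mul_ln_subr_le j.+2%:R j.+1%:R; rewrite !ltr0n => /(_ isT isT).
  by rewrite -lerN2 -mulrN !opprB -natr1 addrAC subrr add0r mulrC -ler_pdivrMr ?natr1 ?ltr0n // mul1r.
have c3 : (j.+1%:R : R)^-1 <= 2 * j.+2%:R^-1.
  rewrite -[2]invrK -invfM lef_pV2 ?posrE ?ltr0n ?mulr_gt0 ?invr_gt0 ?ltr0n //.
  by rewrite mulrC ler_pdivrMr // -natrM ler_nat; lia.
have c4 : j%:R * (j.+1%:R : R)^-1 = 1 - j.+1%:R^-1.
  by rewrite -natr1; field; rewrite natr1 pnatr_eq0.
have c5 : j%:R * (j.+1%:R : R)^-1 <= j%:R * (ln j.+1%:R - ln j%:R) by rewrite ler_wpM2l.
move: IH c1 c2 c3 c4 c5; rewrite -[j.+1%:R]natr1.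
move: (_^-1) => u; move: (_^-1) => v; lra.
Qed.

(** The derivative 1 + ln x of x ln x is unbounded near 0, but there the function itself stays
    between -1 and 0. *)
Lemma mul_ln_close (x y b : R) : 0 <= x -> 0 <= y -> `|x - y| <= 1 -> x <= b -> y <= b -> 1 <= b ->
  `|x * ln x - y * ln y| <= 1 + ln b.
Proof.
wlog xy : x y / y <= x => [hw x0 y0 d xb yb b1|].
  by case: (leP y x) => [|/ltW] xy; [apply: hw|rewrite distrC; apply: hw => //; rewrite distrC].
move=> x0 y0; rewrite ger0_norm ?subr_ge0 // => d xb yb b1.
have b0 := ln_ge0 b1.
have [y00|yn0] := eqVneq y 0.
  rewrite {}y00 in xy y0 d *; rewrite mul0r !subr0 in d *.
  have [->|xn0] := eqVneq x 0; first by rewrite mul0r normr0; lra.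
  have xp : 0 < x by rewrite lt_neqAle eq_sym xn0.
  have := ln_le0 d; have := mul_ln_subr_le xp ltr01; rewrite ln1 => h1 h2.
  rewrite ler_norml; apply/andP; split; first by lra.
  have : x * ln x <= 0 by rewrite mulr_ge0_le0.
  lra.
have yp : 0 < y by rewrite lt_neqAle eq_sym yn0.
have xp : 0 < x by exact: lt_le_trans xy.
have lnxy : ln y <= ln x by rewrite ler_ln.
have h1 := mul_ln_subr_le yp xp; have h2 := mul_ln_subr_le xp ltr01; rewrite ln1 in h2.
have lnb : ln x <= ln b by rewrite ler_ln // posrE (lt_le_trans xp).
have p1 : 0 <= y * (ln x - ln y) by rewrite mulr_ge0 // subr_ge0.
have [lx|lx] := leP 0 (ln x).
  have p2 : 0 <= (x - y) * ln x by rewrite mulr_ge0 // subr_ge0.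
  have p3 : (x - y) * ln x <= ln x by rewrite ler_piMl.
  by rewrite ler_norml; apply/andP; split; lra.
have p2 : (x - y) * ln x <= 0 by rewrite mulr_ge0_le0 ?subr_ge0 // ltW.
have p3 : x * ln x <= (x - y) * ln x by rewrite ler_wnM2r ?(ltW lx) //; lra.
by rewrite ler_norml; apply/andP; split; lra.
Qed.

Lemma floor_or_ceilE (x : R) (j : nat) : floor_or_ceil x j = (`|x - j%:R| < 1).
Proof.
have jE : j%:R = (j%:Z)%:~R :> R by [].
rewrite /floor_or_ceil [in X in X || _]eq_sym [in X in _ || X]eq_sym floor_eq ceil_eq.
rewrite !intrD -jE ltr_norml; apply/idP/idP => [/orP[]/andP[h1 h2]|/andP[h1 h2]].
- by apply/andP; split; lra.
- by apply/andP; split; lra.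
by case: (leP j%:R x) => h; rewrite /= ?andbT; lra.
Qed.

Lemma ln_prod (I : Type) (s : seq I) (F : I -> R) : (forall i, 0 < F i) ->
  ln (\prod_(i <- s) F i) = \sum_(i <- s) ln (F i).
Proof.
move=> F0; elim: s => [|i s IH]; first by rewrite !big_nil ln1.
by rewrite !big_cons lnM ?posrE ?IH // prodr_gt0.
Qed.

(** The linear terms of Stirling's formula cancel because the counts add up to m. The constant 3 q +
    2 covers the rounding of the alpha i * m, the q factorials of the counts and the factorial of
    m. *)
Lemma ln_multinomial_close (q : nat) (alpha : 'I_q -> R) (m : nat) (ks : 'I_q -> nat) :
  (forall i, 0 <= alpha i <= 1) -> \sum_i alpha i = 1 ->
  (forall i, floor_or_ceil (alpha i * m%:R) (ks i)) -> (\sum_i ks i)%N = m ->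
  `|ln (multinomial R m ks) - m%:R * - \sum_i alpha i * ln (alpha i)| <= (3 * q%:R + 2) * (1 + ln m.+1%:R).
Proof.
move=> al al1 fc sk; have L0 : 0 <= ln (m.+1%:R : R) by rewrite ln_ge0 // ler1n.
have ksm i : (ks i <= m)%N by rewrite -sk (bigD1 i) //= leq_addr.
have lnM' : ln (multinomial R m ks) = ln m`!%:R - \sum_i ln (ks i)`!%:R.
  rewrite /multinomial ln_div ?posrE ?ltr0n ?fact_gt0 //; last first.
    by rewrite prodr_gt0 // => i _; rewrite ltr0n fact_gt0.
  by rewrite ln_prod // => i; rewrite ltr0n fact_gt0.
pose sk' := \sum_i (ks i)%:R * ln (ks i)%:R : R.
pose sa := \sum_i (alpha i * m%:R) * ln (alpha i * m%:R) : R.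
have skm : \sum_i (ks i)%:R = m%:R :> R by rewrite -natr_sum sk.
have saE : sa = m%:R * (\sum_i alpha i * ln (alpha i)) + m%:R * ln m%:R.
  have -> : m%:R * ln m%:R = \sum_i alpha i * (m%:R * ln m%:R) by rewrite -mulr_suml al1 mul1r.
  rewrite mulr_sumr -big_split /=; apply: eq_bigr => i _.
  have [->|m0] := posnP m; first by rewrite !mulr0 !mul0r mulr0 addr0.
  have [->|a0] := eqVneq (alpha i) 0; first by rewrite !mul0r mulr0 addr0.
  have ap : 0 < alpha i by rewrite lt_neqAle eq_sym a0; case/andP: (al i).
  by rewrite lnM ?posrE ?ltr0n //; ring.
have close : `|sa - sk'| <= q%:R * (1 + ln m.+1%:R).
  rewrite /sa /sk' -sumrB (le_trans (ler_norm_sum _ _ _)) //.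
  rewrite (le_trans (y := \sum_(i < q) (1 + ln m.+1%:R))) //; last by rewrite sumr_const card_ord mulr_natl.
  apply: ler_sum => i _; have /andP[a0 a1] := al i.
  apply: mul_ln_close => //; rewrite ?mulr_ge0 ?ler1n //.
  - by move: (fc i); rewrite floor_or_ceilE => /ltW.
  - by rewrite -natr1; have : alpha i * m%:R <= m%:R by [rewrite ler_piMl]; lra.
  - by rewrite ler_nat (leq_trans (ksm i)).
have low : sk' - m%:R <= \sum_i ln (ks i)`!%:R.
  by rewrite -skm -sumrB; apply: ler_sum => i _; exact: ln_fact_ge.
have up : \sum_i ln (ks i)`!%:R <= sk' - m%:R + q%:R * (2 * ln m.+1%:R + 1).
  rewrite -skm -sumrB.
  have -> : q%:R * (2 * ln m.+1%:R + 1) = \sum_(i < q) (2 * ln m.+1%:R + 1) :> R.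
    by rewrite sumr_const card_ord mulr_natl.
  rewrite -big_split /=; apply: ler_sum => i _; rewrite (le_trans (ln_fact_le _)) // addrA.
  by rewrite lerD2r lerD2l ler_wpM2l // ler_ln ?posrE ?ltr0n // ler_nat ltnS.
have := ln_fact_ge m; have := ln_fact_le m; rewrite lnM'.
have q0 : 0 <= q%:R * ln m.+1%:R :> R by rewrite mulr_ge0.
have q1 : (0 : R) <= q%:R by [].
move: close; rewrite saE !ler_norml; lra.
Qed.

End Entropy.

(** * Concavity and growth of binomial coefficients *)

Section Binomials.

Variable R : realType.

Lemma concave_ratio (g : nat -> R) (n : nat) : g 0%N = 0 ->
  (forall j, (j.+2 <= n)%N -> g j.+2 - 2 * g j.+1 + g j <= 0) ->
  forall m k, (m <= k <= n)%N -> m%:R * g k <= k%:R * g m.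
Proof.
move=> g0 conc.
have step k : (k < n)%N -> k%:R * g k.+1 <= k.+1%:R * g k.
  elim: k => [|k IH] kn; first by rewrite mul0r g0 mulr0.
  have := conc k kn; have := IH (ltnW kn); rewrite -[k.+2%:R]natr1 -[k.+1%:R]natr1.
  have k0 : (0 : R) <= k%:R by [].
  move=> h1 h2; have : (k%:R + 1) * g k.+2 <= (k%:R + 1) * (2 * g k.+1 - g k) by rewrite ler_wpM2l //; lra.
  lra.
move=> m; elim=> [|k IH] /andP[mk kn]; first by move: mk; rewrite leqn0 => /eqP->.
move: mk; rewrite leq_eqVlt => /orP[/eqP->//|]; rewrite ltnS => mk.
have [k0|k0] := posnP k; first by move: mk; rewrite k0 leqn0 => /eqP->; rewrite g0 mul0r mulr0.
have k0' : (0 : R) < k%:R by rewrite ltr0n.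
rewrite -(ler_pM2l k0').
have h1 : m%:R * (k%:R * g k.+1) <= m%:R * (k.+1%:R * g k) by rewrite ler_wpM2l // step.
have h2 : k.+1%:R * (m%:R * g k) <= k.+1%:R * (k%:R * g m).
  by rewrite ler_wpM2l // IH // mk ltnW.
rewrite [leLHS]mulrCA (le_trans h1) // mulrCA [leRHS]mulrCA; exact: h2.
Qed.

Lemma ln_binS (n j : nat) : (j < n)%N ->
  ln 'C(n, j.+1)%:R - ln 'C(n, j)%:R = ln (n - j)%:R - ln j.+1%:R :> R.
Proof.
move=> jn; have := congr1 (fun x => ln (x%:R : R)) (mul_bin_left n j).
rewrite !natrM !lnM ?posrE ?ltr0n ?bin_gt0 ?subn_gt0 ?(ltnW jn) //; lra.
Qed.

(** The second difference of ln C(n, j) is at most -1/(j+2), hence at most -1/(n+1). Adding j^2 / (2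
    (n+1)) keeps the sequence concave, and the chord inequality for this sum yields the quadratic
    gain. *)
Lemma ln_bin_concave (n m k : nat) : (m <= k <= n)%N ->
  m%:R * ln 'C(n, k)%:R + m%:R * k%:R * (k%:R - m%:R) / (2 * n.+1%:R) <= k%:R * ln 'C(n, m)%:R :> R.
Proof.
move=> mkn; have n0 : (0 : R) < n.+1%:R by rewrite ltr0n.
pose g j : R := ln 'C(n, j)%:R + j%:R ^+ 2 / (2 * n.+1%:R).
have g0 : g 0%N = 0 by rewrite /g bin0 ln1 expr0n /= mul0r addr0.
have conc j : (j.+2 <= n)%N -> g j.+2 - 2 * g j.+1 + g j <= 0.
  move=> jn; rewrite /g.
  have := ln_binS jn; have := ln_binS (ltnW jn).
  have h1 : ln (n - j.+1)%:R <= ln (n - j)%:R :> R by rewrite ler_ln ?posrE ?ltr0n ?subn_gt0 ?ler_nat //; lia.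
  have h2 : n.+1%:R^-1 <= ln j.+2%:R - ln j.+1%:R :> R.
    have := @mul_ln_subr_le R j.+2%:R j.+1%:R; rewrite !ltr0n => /(_ isT isT).
    have -> : j.+1%:R - j.+2%:R = -1 :> R by rewrite -[j.+2%:R]natr1; ring.
    rewrite -lerN2 -mulrN opprB opprK mulrC -ler_pdivrMr ?ltr0n // mul1r.
    by apply: le_trans; rewrite lef_pV2 ?posrE ?ltr0n // ler_nat; lia.
  have E (x : R) : x ^+ 2 / (2 * n.+1%:R) = x ^+ 2 * n.+1%:R^-1 / 2.
    by rewrite invfM mulrA mulrAC.
  rewrite !E; move: h2; move: (n.+1%:R^-1) => u h2.
  have -> : j.+1%:R ^+ 2 = j%:R ^+ 2 + 2 * j%:R + 1 :> R by rewrite -natr1; ring.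
  have -> : j.+2%:R ^+ 2 = j%:R ^+ 2 + 4 * j%:R + 4 :> R by rewrite -natr1 -natr1; ring.
  lra.
have h := concave_ratio g0 conc mkn; rewrite /g !mulrDr in h.
have -> : m%:R * k%:R * (k%:R - m%:R) / (2 * n.+1%:R) =
   m%:R * (k%:R ^+ 2 / (2 * n.+1%:R)) - k%:R * (m%:R ^+ 2 / (2 * n.+1%:R)) :> R.
  by move: (2 * _) => w; move: (w^-1) => u; ring.
by rewrite addrA lerBlDr.
Qed.

(** For j < m each factor (n - j) / (j + 1) of the binomial is at least c. *)
Lemma bin_ge_expn (c n m : nat) : (c.+1 * m <= n)%N -> (c ^ m <= 'C(n, m))%N.
Proof.
elim: m => [|m IH] h; first by rewrite bin0.
have hm : (c.+1 * m <= n)%N by apply: leq_trans h; rewrite leq_mul.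
rewrite -(leq_pmul2l (ltn0Sn m)) mul_bin_left expnS mulnA.
by apply: leq_mul (IH hm); nia.
Qed.

End Binomials.

(** * Rounding the class sizes *)

Section Rounding.

Variables (R : realType) (q : nat) (alpha : 'I_q -> R).
Hypotheses (alpha01 : forall i, 0 <= alpha i <= 1) (alpha1 : \sum_i alpha i = 1).

(* Differences of the truncated partial sums of the alpha i * m. *)
Lemma rounding_exists (m : nat) :
  exists ks : 'I_q -> nat, (forall i, floor_or_ceil (alpha i * m%:R) (ks i)) /\ (\sum_i ks i)%N = m.
Proof.
pose s (i : nat) : R := m%:R * \sum_(j < q | (j < i)%N) alpha j.
have s0 i : 0 <= s i by rewrite mulr_ge0 // sumr_ge0 // => j _; case/andP: (alpha01 j).
have sS (i : 'I_q) : s i.+1 = s i + alpha i * m%:R.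
  rewrite /s addrC [alpha i * _]mulrC -mulrDr; congr (_ * _).
  rewrite (bigD1 i) //=; congr (_ + _).
  by apply: eq_bigl => j; rewrite ltnS ltn_neqAle andbC -val_eqE.
pose f (i : nat) : nat := Num.trunc (s i).
have fP i : (f i)%:R <= s i < (f i).+1%:R by exact: truncn_itv.
have mono (i : 'I_q) : (f i <= f i.+1)%N.
  by apply: le_truncn; rewrite sS lerDl mulr_ge0 //; case/andP: (alpha01 i).
exists (fun i : 'I_q => f i.+1 - f i)%N; split=> [i|].
  rewrite floor_or_ceilE natrB // ltr_norml.
  have := fP i; have := fP i.+1; rewrite sS -!natr1 => /andP[h1 h2] /andP[h3 h4].
  by apply/andP; split; lra.
rewrite -(big_mkord predT (fun i => f i.+1 - f i)%N) telescope_sumn_in // => [|i iq]; last exact: (mono (Ordinal iq)).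
have -> : f 0%N = 0%N by rewrite /f /s big_pred0 ?mulr0 ?truncn0.
rewrite subn0 /f /s (eq_bigl predT) => [|i]; last by rewrite ltn_ord.
by rewrite alpha1 mulr1 natrK.
Qed.

(** T is the latest of the first visits to the values of b, and t is the first visit to b m. *)
Lemma first_visit (F : finType) (b : nat -> F) :
  exists T, forall m, exists t, [/\ (t <= m)%N, (t <= T)%N & b t = b m].
Proof.
have H v : exists t, forall m, b m = v -> b t = v /\ (t <= m)%N.
  have [[m0 h0]|no] := pselect (exists m, b m = v); last by exists 0%N => m h; case: no; exists m.
  have ex : exists m, b m == v by exists m0; apply/eqP.
  by case: (ex_minnP ex) => t /eqP bt tmin; exists t => m bm; split=> //; apply: tmin; apply/eqP.
have [t tP] := choice H.
exists (\max_v t v)%N => m; exists (t (b m)).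
have [bt tm] := tP (b m) m erefl.
by split=> //; exact: leq_bigmax.
Qed.

(* Even counts avoid the parity obstruction coming from the sum of the degrees.  By
   pigeonhole on the fractional parts of the alpha i * m, for some d within a bounded
   distance of m all the alpha i * d are close to integers, which can be doubled. *)
Lemma even_rounding : (0 < q)%N -> exists T : nat, forall m, exists d (ks : 'I_q -> nat),
  [/\ (2 * d <= m)%N, (m <= 2 * d + T)%N, (\sum_i ks i)%N = (2 * d)%N,
      forall i, floor_or_ceil (alpha i * (2 * d)%:R) (ks i) & forall i, ~~ odd (ks i)].
Proof.
move=> q0; have q0' : (0 : R) < q%:R by rewrite ltr0n.
pose fr (m : nat) (i : 'I_q) : R := alpha i * m%:R - (Num.floor (alpha i * m%:R))%:~R.
have fr01 m i : 0 <= fr m i < 1.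
  have /andP[h1 h2] := floor_itv (alpha i * m%:R); rewrite /fr; rewrite intrD in h2.
  by apply/andP; split; lra.
(* With 2q boxes per coordinate, fractional parts in one box differ by less than 1/(2q). The q
   errors then add up to less than 1, so the integers z i sum to exactly d, and each error stays
   below 1 after doubling. *)
pose N := (2 * q).-1; have NE : (2 * q)%:R = N.+1%:R :> R by rewrite prednK ?muln_gt0.
pose b (m : nat) : {ffun 'I_q -> 'I_N.+1} := [ffun i => inord (Num.trunc (N.+1%:R * fr m i))].
have frN m i : 0 <= N.+1%:R * fr m i by rewrite mulr_ge0 //; case/andP: (fr01 m i).
have bE m i : (b m i : nat) = Num.trunc (N.+1%:R * fr m i).
  rewrite ffunE inordK // ltnS -ltnS -(ltr_nat R).
  have /andP[h1 _] := truncn_itv (frN m i); apply: le_lt_trans h1 _.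
  by rewrite gtr_pMr ?ltr0n //; case/andP: (fr01 m i).
have [T TP] := first_visit b.
exists (2 * T + 1)%N => m; have [t [tm tT bt]] := TP (m %/ 2)%N; set m' := (m %/ 2)%N in tm bt.
pose d := (m' - t)%N; pose z i : int := Num.floor (alpha i * m'%:R) - Num.floor (alpha i * t%:R).
have dE : d%:R = m'%:R - t%:R :> R by rewrite natrB.
have zE i : (z i)%:~R = alpha i * d%:R - (fr m' i - fr t i) by rewrite intrB dE /fr; ring.
have frd i : `|fr m' i - fr t i| < (2 * q%:R)^-1.
  rewrite -[X in _ < X]mul1r ltr_pdivlMr ?mulr_gt0 // -natrM NE -[N.+1%:R]ger0_norm // -normrM mulrC mulrBr.
  have := truncn_itv (frN m' i); have := truncn_itv (frN t i); rewrite -!bE bt -!natr1 ltr_norml.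
  by move=> /andP[h1 h2] /andP[h3 h4]; apply/andP; split; lra.
have half1 : (2 * q%:R)^-1 <= 1 / 2 :> R.
  by rewrite invfM mul1r ler_piMr // invf_le1 // ler1n.
have z0 i : 0 <= z i.
  rewrite -ltzD1 -(ltr0z R) intrD zE; have := lt_le_trans (frd i) half1.
  have : 0 <= alpha i * d%:R by rewrite mulr_ge0 //; case/andP: (alpha01 i).
  by rewrite ltr_norml => h /andP[h1 h2]; lra.
have sz : \sum_i z i = d%:Z.
  have : `|(\sum_i z i - d%:Z)%:~R : R| < 1.
    rewrite intrB rmorph_sum /= (eq_bigr _ (fun i _ => zE i)) sumrB -mulr_suml alpha1 mul1r addrAC subrr add0r normrN.
    apply: (le_lt_trans (ler_norm_sum _ _ _)); apply: (le_lt_trans (ler_sum _ (fun i _ => ltW (frd i)))).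
    by rewrite sumr_const card_ord -[ltLHS]mulr_natl invfM mulrCA divff ?lt0r_neq0 // mulr1 invf_lt1 // ltr1n.
  rewrite -intr_norm -[ltRHS]/((1 : int)%:~R) ltr_int; lia.
have zN i : `|z i|%N%:R = (z i)%:~R :> R by rewrite -[in RHS](gez0_abs (z0 i)).
exists d, (fun i => 2 * `|z i|)%N; split.
- lia.
- lia.
- rewrite -big_distrr /=; congr (_ * _)%N.
  apply/eqP; rewrite -(eqr_nat R) natr_sum (eq_bigr _ (fun i _ => zN i)) -rmorph_sum /= sz.
  by [].
- move=> i; rewrite floor_or_ceilE !natrM zN zE; have := lt_le_trans (frd i) half1.
  by rewrite !ltr_norml => /andP[h1 h2]; apply/andP; split; lra.
- by move=> i; rewrite mul2n odd_double.
Qed.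

End Rounding.

(** * Asymptotics *)

Section Asymptotics.

Variable R : realType.

Lemma near_log_le (C eta : R) : 0 < eta ->
  \forall n \near \oo%classic, C * (1 + ln n.+1%:R) <= eta * n%:R.
Proof.
(* The tangent of ln at A = 2/c has slope c/2; the other half of c n absorbs the constants. *)
move=> eta0; pose D := `|C| + 1; pose c := eta / D; pose A := 2 / c.
have D0 : 0 < D by rewrite ltr_wpDl.
have c0 : 0 < c by rewrite divr_gt0.
have A0 : 0 < A by rewrite divr_gt0.
near=> n.
have L0 : 0 <= ln (n.+1%:R : R) by rewrite ln_ge0 // ler1n.
rewrite (le_trans (y := D * (1 + ln n.+1%:R))) //.
  rewrite ler_wpM2r //; first by lra.
  by have := ler_norm C; rewrite /D; lra.
rewrite mulrC -ler_pdivlMr // mulrAC -/c.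
have := @mul_ln_subr_le R A n.+1%:R A0 (ltr0Sn _ _).
have AE x : A * x = (x * 2) / c by rewrite /A; ring.
rewrite AE ler_pdivrMr // !mulrBl -natr1.
have -> : A * c = 2 by rewrite /A divfK ?lt0r_neq0.
have : 1 + 2 * ln A / c <= n%:R by near: n; exact: nbhs_infty_ger.
rewrite -lerBrDl ler_pdivrMr //; lra.
Unshelve. all: by end_near. Qed.

Lemma near_expR_le (C eta delta : R) : 0 < eta -> 0 < delta ->
  \forall n \near \oo%classic, expR (C * (1 + ln n.+1%:R) - eta * n%:R) <= delta.
Proof.
move=> eta0 delta0; have e2 : 0 < eta / 2 by rewrite divr_gt0.
near=> n; rewrite -[leRHS]lnK ?posrE // ler_expR.
have : C * (1 + ln n.+1%:R) <= eta / 2 * n%:R by near: n; exact: near_log_le.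
have : - ln delta / (eta / 2) <= n%:R by near: n; exact: nbhs_infty_ger.
rewrite ler_pdivrMr //; lra.
Unshelve. all: by end_near. Qed.

Lemma bin2_ge (b : nat) : (0 < b)%N -> (b%:R - 1) ^+ 2 / 2 <= 'C(b, 2)%:R :> R.
Proof.
case: b => [//|b] _.
have := congr1 (fun x => x%:R : R) (mul_bin_left b.+1 1).
rewrite bin1 !natrM subSS subn0 -[b.+1%:R]natr1; have : (0 : R) <= b%:R by []; nra.
Qed.

Variables (q : nat) (rho : R).
Hypotheses (q_gt0 : (0 < q)%N) (rho0 : 0 < rho) (rho1 : rho < 1).

(** With b of linear size, (1 + q rho^b)^m is at most exp(m q rho^b), which tends to 1, and rho^C(b,
    2) has a quadratic exponent, which beats q^m. *)
Lemma near_residue_bound_le (delta eta : R) : 0 < delta -> 0 < eta ->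
  \forall n \near \oo%classic, forall m a, (m <= n)%N -> delta * n%:R <= a%:R ->
    residue_bound q rho m a <= (even_residues q)%:R + eta.
Proof.
move=> delta0 eta0; pose M : R := (even_residues q)%:R.
have M0 : 0 < M by rewrite ltr0n even_residues_gt0.
have q0 : (0 : R) < q%:R by rewrite ltr0n.
(* The factor 2 absorbs the rounding of a / q. *)
pose d := delta / (2 * q%:R); have d0 : 0 < d by rewrite divr_gt0 ?mulr_gt0.
pose kap := - ln rho; have kap0 : 0 < kap by rewrite oppr_gt0 ln_lt0 // rho0.
have rhoE (b : nat) : rho ^+ b = expR (- (b%:R * kap)).
  by rewrite mulrN opprK expRM_natl lnK ?posrE.
pose eta1 := ln (1 + eta / 2 / M).
have eta10 : 0 < eta1 by rewrite ln_gt0 // ltrDl !divr_gt0.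
near=> n => m a mn an.
pose b := (a %/ q)%N.
have n1 : 2 / d <= n%:R :> R by near: n; exact: nbhs_infty_ger.
have bn : d * n%:R <= b%:R.
  have : (a < b.+1 * q)%N by exact: ltn_ceil.
  rewrite -(ltr_nat R) natrM -natr1 => h.
  have : delta * n%:R / q%:R < b%:R + 1 by rewrite ltr_pdivrMr //; exact: le_lt_trans h.
  have -> : delta * n%:R / q%:R = 2 * (d * n%:R) by rewrite /d; field; exact: lt0r_neq0.
  move: n1; rewrite ler_pdivrMr //; lra.
have rb : rho ^+ b <= expR (- (d * kap * n%:R)).
  rewrite rhoE ler_expR lerN2 mulrAC ler_wpM2r // ?(ltW kap0) //.
rewrite /residue_bound -/b -/M.
have part1 : M * (1 + q%:R * rho ^+ b) ^+ m <= M + eta / 2.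
  have -> : M + eta / 2 = M * expR eta1.
    rewrite /eta1 lnK; last by rewrite posrE addr_gt0 // !divr_gt0.
    by field; exact: lt0r_neq0.
  rewrite ler_wpM2l ?(ltW M0) //.
  rewrite (le_trans (y := expR (q%:R * rho ^+ b) ^+ m)) //.
    by rewrite lerXn2r ?nnegrE ?expR_ge0 ?expR_ge1Dx // addr_ge0 // mulr_ge0 // exprn_ge0 // ltW.
  rewrite -expRM_natl ler_expR.
  rewrite (le_trans (y := n.+1%:R * (q%:R * expR (- (d * kap * n%:R))))) //.
    rewrite ler_pM ?mulr_ge0 ?exprn_ge0 ?(ltW rho0) // ?ler_nat ?(leq_trans mn) //.
    by rewrite ler_wpM2l.
  rewrite mulrCA -[n.+1%:R]lnK ?posrE ?ltr0n // -expRD mulrC -ler_pdivlMr //.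
  apply: (le_trans (y := expR (1 * (1 + ln n.+1%:R) - d * kap * n%:R))).
    by rewrite ler_expR lerD2r mul1r lerDr.
  by near: n; apply: near_expR_le; [exact: mulr_gt0|exact: divr_gt0].
have part2 : q%:R ^+ m * rho ^+ 'C(b, 2) <= eta / 2.
  have q1 : 1 <= q%:R :> R by rewrite ler1n.
  rewrite (le_trans (y := expR (n%:R * ln q%:R - kap * ((d * n%:R - 1) ^+ 2 / 2)))) //.
    rewrite expRD expRM_natl lnK ?posrE // ler_pM ?exprn_ge0 ?(ltW rho0) ?(ltW q0) //.
      exact: ler_weXn2l.
    rewrite rhoE ler_expR lerN2 [leRHS]mulrC ler_wpM2l ?(ltW kap0) //.
    have b0 : (0 < b)%N by rewrite -(ltr_nat R); move: n1 bn; rewrite ler_pdivrMr //; lra.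
    apply: le_trans (bin2_ge b0); rewrite ler_wpM2r // lerXn2r ?nnegrE ?lerD2r //.
      by move: n1; rewrite ler_pdivrMr //; lra.
    by move: n1 bn; rewrite ler_pdivrMr //; lra.
  apply: (le_trans (y := expR (0 * (1 + ln n.+1%:R) - 1 * n%:R))); last first.
    by near: n; apply: near_expR_le; [exact: ltr01|exact: divr_gt0].
  rewrite ler_expR mul0r mul1r sub0r.
  (* The 8 is 2 from C(b, 2) >= (b - 1)^2 / 2 times 4 from d n - 1 >= d n / 2. *)
  have n2 : (ln q%:R + 1) * 8 / (kap * d ^+ 2) <= n%:R by near: n; exact: nbhs_infty_ger.
  have n0 : 0 <= n%:R :> R by [].
  have kd : 0 < kap * d ^+ 2 := mulr_gt0 kap0 (exprn_gt0 2 d0).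
  move: n2; rewrite ler_pdivrMr // => n2.
  have h : (d * n%:R / 2) ^+ 2 <= (d * n%:R - 1) ^+ 2.
    have n1' : 2 <= d * n%:R by move: n1; rewrite ler_pdivrMr // mulrC.
    by rewrite lerXn2r ?nnegrE //; lra.
  have h2 : kap * (d * n%:R / 2) ^+ 2 <= kap * (d * n%:R - 1) ^+ 2 by rewrite ler_wpM2l ?(ltW kap0).
  have h3 : (ln q%:R + 1) * 8 * n%:R <= n%:R * (kap * d ^+ 2) * n%:R by rewrite ler_wpM2r.
  have h4 : n%:R * (kap * d ^+ 2) * n%:R = 4 * (kap * (d * n%:R / 2) ^+ 2) by field.
  lra.
lra.
Unshelve. all: by end_near. Qed.

End Asymptotics.

(** * The logarithm of the expected number of good sets *)

Definition count_weight (R : realType) (q n m : nat) (ks : 'I_q -> nat) : R :=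
  'C(n, m)%:R * multinomial R m ks * q%:R ^- m.

Section LogWeights.

Variables (R : realType) (q : nat) (alpha : 'I_q -> R).
Hypotheses (q_ge2 : (2 <= q)%N) (alpha01 : forall i, 0 <= alpha i <= 1) (alpha1 : \sum_i alpha i = 1).

Let entropy : R := - \sum_i alpha i * ln (alpha i).

(** Up to [log_error], the logarithm of [count_weight] for every rounding of the alpha i * m at
    once; admissibility is decided by its sign up to that error. *)
Definition log_weight (n m : nat) : R := ln 'C(n, m)%:R + m%:R * (entropy - ln q%:R).

Definition log_error (n : nat) : R := (3 * q%:R + 2) * (1 + ln n.+1%:R).

Let q0 : (0 : R) < q%:R. Proof. by rewrite ltr0n; lia. Qed.

Lemma multinomial_gt0 (m : nat) (ks : 'I_q -> nat) : 0 < multinomial R m ks.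
Proof. by rewrite divr_gt0 ?ltr0n ?fact_gt0 // prodr_gt0 // => i _; rewrite ltr0n fact_gt0. Qed.

Lemma count_weight_gt0 (n m : nat) (ks : 'I_q -> nat) : (m <= n)%N -> 0 < count_weight R n m ks.
Proof.
move=> mn; apply: mulr_gt0; last by rewrite invr_gt0 exprn_gt0.
by apply: mulr_gt0 (multinomial_gt0 m ks); rewrite ltr0n bin_gt0.
Qed.

Lemma ln_count_weight_close (n m : nat) (ks : 'I_q -> nat) : (m <= n)%N ->
  (forall i, floor_or_ceil (alpha i * m%:R) (ks i)) -> (\sum_i ks i)%N = m ->
  `|ln (count_weight R n m ks) - log_weight n m| <= log_error n.
Proof.
move=> mn fc sk; have := ln_multinomial_close alpha01 alpha1 fc sk; rewrite -/entropy.
have b0 : (0 : R) < 'C(n, m)%:R by rewrite ltr0n bin_gt0.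
have p0 := multinomial_gt0 m ks.
rewrite /count_weight lnM ?posrE ?(mulr_gt0 b0 p0) ?invr_gt0 ?exprn_gt0 // lnM ?posrE //.
rewrite lnV ?posrE ?exprn_gt0 // lnXn // -[ln q%:R *+ m]mulr_natl /log_weight.
have -> : ln 'C(n, m)%:R + ln (multinomial R m ks) - m%:R * ln q%:R -
    (ln 'C(n, m)%:R + m%:R * (entropy - ln q%:R)) = ln (multinomial R m ks) - m%:R * entropy by ring.
move/le_trans; apply; rewrite ler_wpM2l ?addr_ge0 ?mulr_ge0 // lerD2l ler_ln ?posrE ?ltr0n //.
by rewrite ler_nat ltnS.
Qed.

(** A rounding exists for each m, so admissibility is never vacuous, and the binomial vanishes
    beyond n. *)
Lemma admissible_le (n m : nat) : admissible alpha n m -> (m <= n)%N.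
Proof.
have [ks [fc sk]] := rounding_exists alpha01 alpha1 m.
move=> /(_ ks fc sk); rewrite leqNgt; apply: contraTN => nm.
by rewrite bin_small // !mul0r -ltNge ltr01.
Qed.

Lemma admissible_log_weight (n m : nat) : admissible alpha n m -> - log_error n <= log_weight n m.
Proof.
move=> adm; have mn := admissible_le adm.
have [ks [fc sk]] := rounding_exists alpha01 alpha1 m.
have := ln_count_weight_close mn fc sk; rewrite ler_norml => /andP[_ h].
by have : 0 <= ln (count_weight R n m ks) by [apply: ln_ge0; exact: adm]; lra.
Qed.

Lemma log_weight_admissible (n m : nat) : (m <= n)%N -> log_error n <= log_weight n m -> admissible alpha n m.
Proof.
move=> mn h ks fc sk; have := ln_count_weight_close mn fc sk; rewrite ler_norml => /andP[h1 _].
rewrite -/(count_weight R n m ks) leNgt; apply/negP => w1.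
have : ln (count_weight R n m ks) < 0 by apply: ln_lt0; rewrite count_weight_gt0.
lra.
Qed.

Lemma log_error_ge0 n : 0 <= log_error n.
Proof. by rewrite mulr_ge0 ?addr_ge0 ?mulr_ge0 // ln_ge0 // ler1n. Qed.

Lemma entropy_ge0 : 0 <= entropy.
Proof.
rewrite oppr_ge0; apply: sumr_le0 => i _; have /andP[a0 a1] := alpha01 i.
by rewrite mulr_ge0_le0 // ln_le0.
Qed.

(* Together with the value 0 at m = 0, this makes log_weight linearly positive below
   and linearly negative above the index where it changes sign. *)
Lemma log_weight_concave (n m k : nat) : (m <= k <= n)%N ->
  m%:R * log_weight n k + m%:R * k%:R * (k%:R - m%:R) / (2 * n.+1%:R) <= k%:R * log_weight n m.
Proof.
move=> mkn; have := ln_bin_concave R mkn; rewrite /log_weight.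
have -> : m%:R * (ln 'C(n, k)%:R + k%:R * (entropy - ln q%:R)) =
  m%:R * ln 'C(n, k)%:R + k%:R * (m%:R * (entropy - ln q%:R)) by ring.
by move=> h; rewrite addrAC [leRHS]mulrDr lerD2r.
Qed.

(** For m about n / (2q + 1) the binomial is at least (2q)^m; against q^-m this leaves 2^m, which
    exceeds the polynomial error. *)
Lemma near_linear_admissible : \forall n \near \oo%classic, exists2 m, admissible alpha n m & n%:R / (4 * q%:R) <= m%:R :> R.
Proof.
have l2 : 0 < ln 2 :> R by rewrite ln_gt0 // ltr1n.
have lq : 0 < ln 2 / (4 * q%:R) :> R by rewrite divr_gt0 // mulr_gt0.
near=> n; pose m := (n %/ (2 * q).+1)%N.
have mn : ((2 * q).+1 * m <= n)%N by rewrite mulnC leq_trunc_div.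
have q2 : (2 : R) <= q%:R by rewrite (ler_nat R 2).
have nm : n%:R / (4 * q%:R) <= m%:R :> R.
  have : (n < m.+1 * (2 * q).+1)%N by exact: ltn_ceil.
  rewrite -(ltr_nat R) natrM -[m.+1%:R]natr1 -[(2 * q).+1%:R]natr1 natrM => h.
  rewrite ler_pdivrMr ?mulr_gt0 //.
  have h2 : 4 * (4 * q%:R + 1) <= n%:R :> R by near: n; exact: nbhs_infty_ger.
  have m0 : (0 : R) <= m%:R by [].
  nra.
exists m => //; apply: log_weight_admissible.
  by apply: leq_trans mn; rewrite leq_pmull.
have h1 : m%:R * ln 2 <= log_weight n m.
  rewrite /log_weight; have := bin_ge_expn mn; rewrite -(ler_nat R) natrX => h1.
  have : ln ((2 * q)%:R ^+ m) <= ln 'C(n, m)%:R :> R.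
    have q20 : (0 : R) < (2 * q)%:R by rewrite natrM mulr_gt0.
    rewrite ler_ln ?posrE ?exprn_gt0 // ltr0n bin_gt0.
    by apply: leq_trans mn; rewrite leq_pmull.
  rewrite lnXn ?natrM ?mulr_gt0 // lnM ?posrE // -[X in X <= _]mulr_natl => h2.
  have h3 : 0 <= m%:R * entropy by rewrite mulr_ge0 // entropy_ge0.
  lra.
apply: le_trans h1; rewrite (le_trans (y := ln 2 / (4 * q%:R) * n%:R)) //.
  by near: n; exact: (near_log_le _ lq).
by rewrite [leRHS]mulrC -mulrA ler_wpM2l ?(ltW l2) // mulrC.
Unshelve. all: by end_near. Qed.

Variable (k : nat -> nat).
Hypothesis greatest : \forall n \near \oo%classic, is_greatest_admissible alpha n (k n).

Lemma near_greatest_bounds : \forall n \near \oo%classic, n%:R / (4 * q%:R) <= (k n)%:R :> R /\ (k n <= n)%N.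
Proof.
near=> n.
have [_ adm max] : is_greatest_admissible alpha n (k n) by near: n.
have [m am nm] : exists2 m, admissible alpha n m & n%:R / (4 * q%:R) <= m%:R :> R.
  by near: n; exact: near_linear_admissible.
split; last exact: admissible_le adm.
by rewrite (le_trans nm) // ler_nat max.
Unshelve. all: by end_near. Qed.

Variable (eps : R).
Hypotheses (eps0 : 0 < eps).

(** The concavity gain m k (k - m) / (2 (n+1)), divided by one index, is at least (n / 8q) (eps n /
    2) / (4n) = c n below k and 2 c n above it, where half is spent on the error. *)
Let c := eps / (64 * q%:R).
Let c0 : 0 < c. Proof. by rewrite divr_gt0 ?mulr_gt0. Qed.

(** The index k + 1 is not admissible, so its log weight is at most the error; concavity carries
    this to m, multiplying the error by m / (k + 1), which is at most 4 q. *)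
Lemma near_log_weight_above : \forall n \near \oo%classic, forall m, (m <= n)%N ->
  (k n)%:R + eps * n%:R <= m%:R -> log_weight n m <= - c * n%:R.
Proof.
near=> n => m mn km.
have [_ adm max] : is_greatest_admissible alpha n (k n) by near: n.
have [nk kn] : n%:R / (4 * q%:R) <= (k n)%:R :> R /\ (k n <= n)%N by near: n; exact: near_greatest_bounds.
pose K := (k n).+1.
have n1 : 2 / eps <= n%:R by near: n; exact: nbhs_infty_ger.
have n1' : 2 <= eps * n%:R by move: n1; rewrite ler_pdivrMr // mulrC.
have Km : (K <= m)%N by rewrite -(ltr_nat R); lra.
have K0 : (0 : R) < K%:R by rewrite ltr0n.
have wK : log_weight n K <= log_error n.
  rewrite leNgt; apply/negP => h.
  have := max K (log_weight_admissible (leq_trans Km mn) (ltW h)).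
  by rewrite ltnn.
have := @log_weight_concave n K m; rewrite Km mn => /(_ isT) h.
have err : (4 * q%:R) * log_error n <= c * n%:R.
  by rewrite /log_error mulrA; near: n; exact: (near_log_le _ c0).
have e0 := log_error_ge0 n.
have m0 : (0 : R) < m%:R by rewrite ltr0n; exact: leq_trans Km.
have h1 : K%:R * (log_weight n m + m%:R * (m%:R - K%:R) / (2 * n.+1%:R)) <= m%:R * log_error n.
  rewrite (le_trans (y := m%:R * log_weight n K)) ?ler_pM2l //.
  by rewrite (le_trans _ h) // le_eqVlt; apply/orP; left; apply/eqP; ring.
have h2 : m%:R * log_error n <= K%:R * (4 * q%:R * log_error n).
  rewrite mulrA ler_wpM2r //; have : (m%:R : R) <= n%:R by rewrite ler_nat.
  have -> : K%:R * (4 * q%:R) = (k n)%:R * (4 * q%:R) + 4 * q%:R :> R by rewrite /K -natr1; ring.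
  move: nk; rewrite ler_pdivrMr ?mulr_gt0 //; move: (_ * (4 * _)) => x nx mn'.
  by rewrite (le_trans mn') // (le_trans nx) // lerDl mulr_ge0 // ltW.
have {h1 h2} h3 : log_weight n m + m%:R * (m%:R - K%:R) / (2 * n.+1%:R) <= 4 * q%:R * log_error n.
  by rewrite -(ler_pM2l K0) (le_trans h1).
have n0 : (0 : R) < n%:R by rewrite (lt_le_trans m0) // ler_nat.
have n2 : (0 : R) < 2 * n.+1%:R by rewrite mulr_gt0 // ltr0n.
suff h4 : 2 * c * n%:R <= m%:R * (m%:R - K%:R) / (2 * n.+1%:R).
  move: h3 h4 err; move: (m%:R * (m%:R - K%:R) / _) (4 * q%:R * _) => X Y; lra.
rewrite ler_pdivlMr //.
have h5 : n%:R / (4 * q%:R) * (eps * n%:R / 2) <= m%:R * (m%:R - K%:R).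
  apply: ler_pM.
  - by rewrite divr_ge0 // mulr_ge0 // ltW.
  - by rewrite divr_ge0 // mulr_ge0 // ltW.
  - by apply: le_trans nk _; rewrite ler_nat ltnW.
  - by rewrite /K -[(k n).+1%:R]natr1; lra.
apply: le_trans h5; rewrite /c.
have -> : n%:R / (4 * q%:R) * (eps * n%:R / 2) = 2 * (eps / (64 * q%:R)) * n%:R * (4 * n%:R).
  by field; exact: lt0r_neq0.
rewrite -/c ler_pM2l ?(mulr_gt0 (mulr_gt0 _ c0) n0) // -[n.+1%:R]natr1.
have : 1 <= n%:R :> R by rewrite ler1n -(ltr_nat R).
lra.
Unshelve. all: by end_near. Qed.

Lemma near_log_weight_below : \forall n \near \oo%classic, forall m, n%:R / (8 * q%:R) <= m%:R :> R ->
  m%:R + eps / 2 * n%:R <= (k n)%:R -> c * n%:R - log_error n <= log_weight n m.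
Proof.
near=> n => m nm mk.
have [_ adm _] : is_greatest_admissible alpha n (k n) by near: n.
have kn := admissible_le adm; have wk := admissible_log_weight adm.
have n1 : 1 <= n%:R :> R by near: n; exact: nbhs_infty_ger.
have n0 : (0 : R) < n%:R by lra.
have en : 0 < eps * n%:R by rewrite mulr_gt0.
have mk' : (m <= k n)%N by rewrite -(ler_nat R); lra.
have := @log_weight_concave n m (k n); rewrite mk' kn => /(_ isT) h.
have e0 := log_error_ge0 n.
have m0 : (0 : R) < m%:R by rewrite (lt_le_trans _ nm) // divr_gt0 ?mulr_gt0.
have k0 : (0 : R) < (k n)%:R by rewrite (lt_le_trans m0) // ler_nat.
have h1 : (k n)%:R * (m%:R * ((k n)%:R - m%:R) / (2 * n.+1%:R) - log_error n) <= (k n)%:R * log_weight n m.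
  apply: le_trans h; rewrite mulrBr addrC; apply: lerD.
    rewrite lerNl -mulrN (le_trans (y := m%:R * log_error n)) //.
      by rewrite ler_wpM2l // ?(ltW m0) // lerNl.
    by rewrite ler_wpM2r // ler_nat.
  by rewrite le_eqVlt; apply/orP; left; apply/eqP; ring.
move: h1; rewrite ler_pM2l // => h1; apply: le_trans h1; rewrite lerD2r.
have n2 : (0 : R) < 2 * n.+1%:R by rewrite mulr_gt0 // ltr0n.
rewrite ler_pdivlMr //.
apply: (le_trans (y := n%:R / (8 * q%:R) * (eps / 2 * n%:R))); last first.
  apply: ler_pM.
  - by rewrite divr_ge0 // mulr_ge0 // ltW.
  - by rewrite mulr_ge0 ?divr_ge0 // ltW.
  - exact: nm.
  - by lra.
have -> : n%:R / (8 * q%:R) * (eps / 2 * n%:R) = c * n%:R * (4 * n%:R).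
  by rewrite /c; field; exact: lt0r_neq0.
rewrite ler_pM2l ?(mulr_gt0 c0 n0) // -[n.+1%:R]natr1; lra.
Unshelve. all: by end_near. Qed.

End LogWeights.

(* Every set S' counted has weight z^|S' symdiff S| at least z^(2 a0). *)
Lemma card_near_sets_le (R : realFieldType) (V : finType) (m a0 : nat) (z : R) (S : {set V}) :
  0 < z <= 1 -> #|S| = m ->
  #|[set S' : {set V} | (#|S'| == m) && (#|S :\: S'| < a0)%N]|%:R * z ^+ (2 * a0) <= (1 + z) ^+ #|V|.
Proof.
move=> /andP[z0 z1] Sm.
(* Choosing J vertex by vertex costs z exactly where J and S disagree. *)
pose F (v : V) : R := if v \in S then 1 else z; pose G (v : V) : R := if v \in S then z else 1.
have -> : (1 + z) ^+ #|V| = \prod_v (F v + G v).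
  rewrite -prodr_const; apply: eq_big => // v _; rewrite /F /G.
  by case: ifP => // _; rewrite addrC.
have -> : \prod_v (F v + G v) = \sum_(J : {set V}) \prod_v (if v \in J then F v else G v).
  exact: (@bigA_distr R 0 1 _ _ V F G).
have E (J : {set V}) : \prod_v (if v \in J then F v else G v) = z ^+ (#|S :\: J| + #|J :\: S|).
  rewrite exprD -!prodr_const [in RHS]big_mkcond [X in _ = _ * X]big_mkcond -big_split /=.
  apply: eq_bigr => v _; rewrite /F /G !inE.
  by case: (v \in J); case: (v \in S); rewrite /= ?mulr1 ?mul1r.
rewrite (eq_bigr _ (fun J _ => E J)).
rewrite -sum1dep_card natr_sum mulr_suml [leRHS](bigID (fun S' : {set V} => (#|S'| == m) && (#|S :\: S'| < a0)%N)) /=.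
rewrite -[leLHS]addr0 lerD //; last by apply: sumr_ge0 => J _; rewrite exprn_ge0 // ltW.
apply: ler_sum => J /andP[/eqP Jm Ja]; rewrite mul1r; apply: ler_wiXn2l => //; first exact: ltW.
have cJ : #|J :\: S| = #|S :\: J|.
  by apply/eqP; rewrite -(eqn_add2l #|J :&: S|) cardsID setIC cardsID Sm Jm.
by rewrite cJ addnn -mul2n leq_mul2l ltnW.
Qed.

(** * From good sets to the parameter [f] *)

Section InducedSubgraphs.

Variables (R : realType) (q : nat) (alpha : 'I_q -> R) (V : finType).
Hypothesis q_gt0 : (0 < q)%N.

Lemma residue_sets_le_f (m : nat) (ks : 'I_q -> nat) (G : sgraph V) :
  (forall i, floor_or_ceil (alpha i * m%:R) (ks i)) -> (0 < residue_sets m ks G)%N -> (m <= f alpha G)%N.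
Proof.
move=> fc /card_gt0P[S]; rewrite inE => /andP[/eqP Sm /forallP Sk].
rewrite -Sm; apply: (@leq_bigmax_cond _ _ (fun S : {set V} => #|S|)).
by apply/forallP => i; rewrite Sm (eqP (Sk i)).
Qed.

Lemma sum_card_deg_class (G : sgraph V) (S : {set V}) : (\sum_(i < q) #|deg_class G q S i| = #|S|)%N.
Proof.
rewrite -[RHS]sum1_card.
rewrite [RHS](partition_big (fun v => Ordinal (ltn_pmod (induced_deg G S v) q_gt0)) predT) //=.
apply: eq_bigr => i _; rewrite sum1dep_card; apply: eq_card => v; rewrite !inE.
by rewrite -val_eqE /= (modn_small (ltn_ord i)).
Qed.

Lemma f_attained (G : sgraph V) : exists2 S : {set V}, deg_distributed alpha G S & #|S| = f alpha G.
Proof.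
have d0 : deg_distributed alpha G finset.set0.
  apply/forallP => i; rewrite floor_or_ceilE cards0 mulr0 sub0r normrN.
  rewrite (_ : deg_class _ _ _ _ = finset.set0) ?cards0 ?normr0 ?ltr01 //.
  by apply/setP => v; rewrite !inE.
have [|S Sd E] := @eq_bigmax_cond _ (deg_distributed alpha G) (fun S : {set V} => #|S|).
  by apply/card_gt0P; exists finset.set0.
by exists S => //; symmetry; exact: E.
Qed.

(** Size and class counts are packed into a finite type, so that the union bound over them is a
    finite sum with polynomially many terms. *)
Lemma f_ge_residue_sets (G : sgraph V) : exists p : 'I_#|V|.+1 * {ffun 'I_q -> 'I_#|V|.+1},
  [/\ p.1 = f alpha G :> nat, forall i, floor_or_ceil (alpha i * p.1%:R) (p.2 i),
      (\sum_i p.2 i)%N = p.1 & (0 < residue_sets p.1 (fun i => p.2 i) G)%N].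
Proof.
have [S Sd Sf] := f_attained G.
have cS (A : {set V}) : (#|A| < #|V|.+1)%N by rewrite ltnS max_card.
exists (Ordinal (cS S), [ffun i : 'I_q => Ordinal (cS (deg_class G q S i))]); split=> //=.
- by move=> i; rewrite ffunE; move/forallP: Sd => /(_ i).
- by rewrite -[RHS](sum_card_deg_class G); apply: eq_bigr => i _; rewrite ffunE.
apply/card_gt0P; exists S; rewrite inE eqxx; apply/forallP => i; by rewrite ffunE.
Qed.

End InducedSubgraphs.

Lemma gprob_union_le (R : realFieldType) (V I : finType) (P : pred I) (A : I -> pred (sgraph V)) (B : pred (sgraph V)) :
  (forall G, B G -> exists2 i, P i & A i G) -> gprob R B <= \sum_(i | P i) gprob R (A i).
Proof.
move=> BA; rewrite gprob_sum (eq_bigr _ (fun i _ => gprob_sum R (A i))) -mulr_suml ler_wpM2r ?invr_ge0 //.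
rewrite exchange_big /=; apply: ler_sum => G _; case: (boolP (B G)) => [/BA[i Pi Ai]|_]; last exact: sumr_ge0.
by rewrite (bigD1 i) //= Ai lerDl sumr_ge0.
Qed.

Lemma multinomial_card (R : realType) (q m : nat) (ks : 'I_q -> nat) : (\sum_i ks i)%N = m ->
  multinomial R m ks = #|tuples_with_counts m ks|%:R.
Proof.
move=> sk; rewrite /multinomial -(card_tuples_with_counts sk) natrM -natr_prod mulfK //.
by rewrite pnatr_eq0 -lt0n prodn_gt0 // => i; rewrite fact_gt0.
Qed.

(** The ratio is at most 1 + 4 eta, whose square is at most 1 + 16 eta; hence e / 32. *)
Lemma second_moment_ratio_le (R : realFieldType) (M eta e : R) :
  1 <= M -> 0 < eta -> eta <= 1 / 2 -> eta <= e / 32 ->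
  ((M + eta) / (2 * M - (M + eta))) ^+ 2 <= 1 + e / 2.
Proof.
move=> M1 eta0 eta1 eta2; have D0 : 0 < 2 * M - (M + eta) by lra.
apply: (@le_trans _ _ ((1 + 4 * eta) ^+ 2)); last by nra.
have h : (M + eta) / (2 * M - (M + eta)) <= 1 + 4 * eta by rewrite ler_pdivrMr //; nra.
rewrite lerXn2r ?nnegrE //; last by lra.
by rewrite divr_ge0 //; lra.
Qed.

(** Both factors cost c n / 4 in the exponent: (1 + z)^n through z = c / 4, and z^(-2 a0) through
    the choice of delta. The rounding of a0 costs the constant -2 ln z. *)
Lemma near_sets_expR_le (R : realType) (c z delta : R) (n a0 : nat) :
  0 < z -> z <= 1 -> z = c / 4 -> 0 <= c <= 1 -> 0 <= delta -> delta * (1 - ln z) = c / 8 ->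
  a0%:R <= delta * n%:R + 1 ->
  (1 + z) ^+ n / z ^+ (2 * a0) <= expR (c / 2 * n%:R + 2 * - ln z).
Proof.
move=> z0 z1 zc /andP[c0 c1] d0 dz a0n; set kz := - ln z in dz *.
have kz0 : 0 <= kz by rewrite oppr_ge0 ln_le0.
have zE : z ^+ (2 * a0) = expR (- ((2 * a0)%:R * kz)).
  by rewrite -mulrN /kz opprK expRM_natl lnK ?posrE.
rewrite zE expRN invrK (le_trans (y := expR z ^+ n * expR ((2 * a0)%:R * kz))) //.
  by rewrite ler_wpM2r ?expR_ge0 // lerXn2r ?nnegrE ?expR_ge0 ?expR_ge1Dx // addr_ge0 // ltW.
rewrite -expRM_natl -expRD ler_expR natrM.
have h1 : a0%:R * kz <= (delta * n%:R + 1) * kz by rewrite ler_wpM2r.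
have h2 : delta * kz * n%:R <= c / 8 * n%:R by rewrite ler_wpM2r // -dz ler_wpM2l // lerDr.
have h3 : 0 <= c * n%:R by rewrite mulr_ge0.
by rewrite zc; lra.
Qed.

Lemma second_moment_gap (R : realFieldType) (M eta : R) :
  1 <= M -> eta <= 1 / 2 -> 1 / 2 <= 2 * M - (M + eta).
Proof. by lra. Qed.

(** * Upper and lower tails of [f] *)

Section Concentration.

Variables (R : realType) (q : nat) (alpha : 'I_q -> R) (k : nat -> nat) (eps : R).
Hypotheses (q_ge2 : (2 <= q)%N) (alpha01 : forall i, 0 <= alpha i <= 1) (alpha1 : \sum_i alpha i = 1)
  (greatest : \forall n \near \oo%classic, is_greatest_admissible alpha n (k n))
  (eps0 : 0 < eps) (eps_le : eps <= (8 * q%:R)^-1).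

Let q_gt0 : (0 < q)%N. Proof. exact: ltnW. Qed.
Let q0 : (0 : R) < q%:R. Proof. by rewrite ltr0n. Qed.
Let M : R := (even_residues q)%:R.
Let M1 : 1 <= M. Proof. by rewrite ler1n even_residues_gt0. Qed.
Let c := eps / (64 * q%:R).
Let c0 : 0 < c. Proof. by rewrite divr_gt0 ?mulr_gt0. Qed.

Let mean_weight (n m : nat) (ks : 'I_q -> nat) : (\sum_i ks i)%N = m ->
  'C(#|'I_n|, m)%:R * #|tuples_with_counts m ks|%:R * q%:R ^- m =
  count_weight R n m ks.
Proof. by move=> sk; rewrite card_ord /count_weight multinomial_card. Qed.

Lemma near_f_above (e : R) : 0 < e -> \forall n \near \oo%classic,
  gprob R (fun G : sgraph 'I_n => (k n)%:R + eps * n%:R <= (f alpha G)%:R) <= e.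
Proof.
move=> e0; have [rho /andP[rho0 rho1] bounds] := residue_prob_bounds R q_gt0.
have M10 : 0 < M + 1 by rewrite addr_gt0 // (lt_le_trans ltr01).
have eM0 : 0 < e / (M + 1) by rewrite divr_gt0.
have dq0 : 0 < (4 * q%:R)^-1 :> R by rewrite invr_gt0 mulr_gt0.
near=> n.
have [nk kn] : n%:R / (4 * q%:R) <= (k n)%:R :> R /\ (k n <= n)%N.
  by near: n; exact: (near_greatest_bounds q_ge2 alpha01 alpha1 greatest).
pose I : finType := ('I_#|'I_n|.+1 * {ffun 'I_q -> 'I_#|'I_n|.+1})%type.
pose P (p : I) := [&& (k n)%:R + eps * n%:R <= p.1%:R,
  [forall i, floor_or_ceil (alpha i * p.1%:R) (p.2 i)] & (\sum_i p.2 i == p.1)%N].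
pose T := expR (log_error R q n - c * n%:R) * (M + 1).
have T0 : 0 <= T by rewrite mulr_ge0 ?expR_ge0 // ltW.
apply: (@le_trans _ _ (\sum_(p | P p) gprob R (fun G : sgraph 'I_n => (0 < residue_sets p.1 (fun i => p.2 i) G)%N))).
  apply: gprob_union_le => G Gk; have [p [p1 p2 p3 p4]] := f_ge_residue_sets alpha q_gt0 G.
  by exists p => //; apply/and3P; split; [rewrite p1|apply/forallP|apply/eqP].
apply: (@le_trans _ _ (\sum_(p : I) T)).
  rewrite [leRHS](bigID P) /= -[leLHS]addr0 lerD ?sumr_ge0 //; apply: ler_sum => p /and3P[p1 /forallP p2 /eqP p3].
  apply: (le_trans (gprob_residue_sets_le p.1 (fun i => p.2 i) q_gt0 (@bounds _))).
  rewrite mulrA (mean_weight n p3).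
  have mn : (p.1 <= n)%N by have := ltn_ord p.1; rewrite ltnS => /leq_trans; apply; rewrite card_ord.
  have w0 := count_weight_gt0 R q_ge2 (fun i => p.2 i) mn.
  apply: ler_pM; rewrite ?(ltW w0) //.
  - by rewrite addr_ge0 ?mulr_ge0 ?exprn_ge0 ?addr_ge0 ?mulr_ge0 ?exprn_ge0 // ltW.
  - rewrite -[leLHS]lnK ?posrE // ler_expR.
    have := ln_count_weight_close q_ge2 alpha01 alpha1 mn p2 p3; rewrite ler_norml => /andP[_ h].
    have : log_weight alpha n p.1 <= - c * n%:R.
      have {}H : forall m, (m <= n)%N -> (k n)%:R + eps * n%:R <= m%:R -> log_weight alpha n m <= - c * n%:R.
        by near: n; exact: (near_log_weight_above q_ge2 alpha01 alpha1 greatest eps0).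
      exact: H.
    lra.
  have {}H : forall m a, (m <= n)%N -> (4 * q%:R)^-1 * n%:R <= a%:R :> R -> residue_bound q rho m a <= M + 1.
    by near: n; exact: (near_residue_bound_le q_gt0 rho0 rho1 dq0 ltr01).
  have en0 : 0 <= eps * n%:R by rewrite mulr_ge0 // (ltW eps0).
  by apply: H => //; rewrite mulrC (le_trans nk) // (le_trans _ p1) // lerDl.
rewrite sumr_const card_prod card_ffun !card_ord -expnS -[leLHS]mulr_natl natrX /T.
(* 4 q + 3 is q + 1 from the (n+1)^(q+1) pairs of size and counts, plus 3 q + 2 from [log_error]. *)
rewrite mulrA -ler_pdivlMr //; apply: (@le_trans _ _ (expR ((4 * q%:R + 3) * (1 + ln n.+1%:R) - c * n%:R))).
  rewrite -[n.+1%:R in leLHS]lnK ?posrE ?ltr0n // -expRM_natl -expRD ler_expR /log_error addrA lerD2r.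
  by rewrite -[q.+1%:R]natr1; move: (ln _) q0 => L qp; lra.
by near: n; exact: (near_expR_le _ c0 eM0).
Unshelve. all: by end_near. Qed.

Lemma near_f_below (e : R) : 0 < e -> \forall n \near \oo%classic,
  gprob R (fun G : sgraph 'I_n => (f alpha G)%:R < (k n)%:R - eps * n%:R) <= e.
Proof.
move=> e0; have [rho /andP[rho0 rho1] bounds] := residue_prob_bounds R q_gt0.
have [T TP] := even_rounding alpha01 alpha1 q_gt0.
pose eta := Num.min (1 / 2) (e / 32).
have eta0 : 0 < eta by rewrite lt_min !divr_gt0.
have eta1 : eta <= 1 / 2 by rewrite ge_min lexx.
have eta2 : eta <= e / 32 by rewrite ge_min lexx orbT.
have eps1 : eps <= 1.
  by rewrite (le_trans eps_le) // invf_le1 ?mulr_gt0 // -(natrM _ 8) ler1n muln_gt0.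
have c1 : c <= 1.
  by rewrite ler_pdivrMr ?mulr_gt0 // mul1r (le_trans eps1) // -(natrM _ 64) ler1n muln_gt0.
pose z := c / 4; have z0 : 0 < z by rewrite divr_gt0.
have z1 : z <= 1 by rewrite /z; lra.
pose kz := - ln z; have kz0 : 0 <= kz by rewrite oppr_ge0 ln_le0.
pose delta := c / (8 * (kz + 1)).
have kz1 : 0 < 8 * (kz + 1) by rewrite mulr_gt0 // ltr_wpDl.
have delta0 : 0 < delta by rewrite divr_gt0.
have delta_kz : delta * (kz + 1) = c / 8 by rewrite /delta; field; rewrite lt0r_neq0 // ltr_wpDl.
(* Small enough that a0, about delta n, does not exceed m, which is at least n / (8 q). *)
have delta1 : delta <= (16 * q%:R)^-1.
  have : delta <= c / 8 by rewrite -delta_kz ler_pMr // lerDr.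
  have -> : (16 * q%:R)^-1 = 4 * (64 * q%:R)^-1 :> R by field; exact: lt0r_neq0.
  have : c <= 1 * (64 * q%:R)^-1 by rewrite ler_wpM2r // invr_ge0 mulr_ge0 // ltW.
  have : 0 <= (64 * q%:R)^-1 :> R by rewrite invr_ge0 mulr_ge0 // ltW.
  move: (_^-1) => v; lra.
have c20 : 0 < c / 2 by rewrite divr_gt0.
have e40 : 0 < e / 4 by rewrite divr_gt0.
near=> n.
have [nk kn] : n%:R / (4 * q%:R) <= (k n)%:R :> R /\ (k n <= n)%N.
  by near: n; exact: (near_greatest_bounds q_ge2 alpha01 alpha1 greatest).
have n16 : 16 * q%:R <= n%:R :> R by near: n; exact: nbhs_infty_ger.
have n0 : (0 : R) < n%:R by apply: lt_le_trans n16; rewrite mulr_gt0.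
have nT : (T%:R + 1) * 2 / eps <= n%:R by near: n; exact: nbhs_infty_ger.
(* As k is at least n / (4 q), the assumption on eps keeps m above n / (8 q). *)
have en : eps * n%:R <= n%:R / (8 * q%:R) :> R by rewrite [leRHS]mulrC ler_wpM2r // ltW.
have n84 : n%:R / (4 * q%:R) = 2 * (n%:R / (8 * q%:R)) :> R by field; exact: lt0r_neq0.
have n8 : 0 < n%:R / (8 * q%:R) :> R by rewrite divr_gt0 // mulr_gt0.
(* Aiming halfway leaves eps n / 2 above m, for a linearly positive log weight, and eps n / 2 below
   x, for the truncation and the loss T of the even rounding. *)
pose x := (k n)%:R - eps / 2 * n%:R.
have x0 : 0 <= x by rewrite /x; lra.
have /andP[ux xu] := truncn_itv x0; set u := Num.trunc x in ux xu.
have [d [ks [du ud sk fc ev]]] := TP u; set m := (2 * d)%N in du ud sk fc.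
have mx : m%:R <= x by apply: le_trans ux; rewrite ler_nat.
have xm : (k n)%:R - eps * n%:R <= m%:R.
  have : u%:R <= m%:R + T%:R :> R by rewrite -natrD ler_nat.
  move: nT xu; rewrite ler_pdivrMr // -[u.+1%:R]natr1 /x; lra.
have m8 : n%:R / (8 * q%:R) <= m%:R :> R.
  by move: nk en xm; rewrite n84; move: (n%:R / (8 * q%:R)) => y; lra.
have mn : (m <= n)%N.
  by apply: leq_trans kn; rewrite -(ler_nat R) (le_trans mx) // /x gerDl oppr_le0 mulr_ge0 // ?divr_ge0 // ltW.
have m_gt0 : (0 < m)%N by rewrite -(ltr_nat R) (lt_le_trans n8).
pose a0 := (Num.trunc (delta * n%:R)).+1.
have dn0 : 0 <= delta * n%:R by rewrite mulr_ge0 // ltW.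
have /andP[a0l a0u] := truncn_itv dn0; rewrite -/a0 in a0u.
have a0x : a0%:R <= delta * n%:R + 1 by rewrite /a0 -natr1 lerD2r.
have a0m : (a0 <= m)%N.
  rewrite -(ler_nat R) (le_trans a0x) // (le_trans _ m8) //.
  have h1 : delta * n%:R <= (16 * q%:R)^-1 * n%:R by rewrite ler_wpM2r // ltW.
  have h2 : 1 <= (16 * q%:R)^-1 * n%:R :> R by rewrite mulrC ler_pdivlMr ?mul1r ?mulr_gt0.
  have h3 : n%:R / (8 * q%:R) = 2 * ((16 * q%:R)^-1 * n%:R) :> R by field; exact: lt0r_neq0.
  by rewrite h3; lra.
pose B := (1 + z) ^+ n / z ^+ (2 * a0).
have B0 : 0 <= B by rewrite divr_ge0 ?exprn_ge0 ?addr_ge0 // ltW.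
have near_le (S : {set 'I_n}) : #|S| = m ->
    #|[set S' : {set 'I_n} | (#|S'| == m) && (#|S :\: S'| < a0)%N]|%:R <= B.
  move=> Sm; rewrite /B ler_pdivlMr ?exprn_gt0 //.
  by have := @card_near_sets_le R 'I_n m a0 z S; rewrite z0 z1 card_ord => /(_ isT Sm).
have tau_le a : (a0 <= a <= m)%N -> residue_bound q rho m a <= M + eta.
  move=> /andP[a0a am].
  have {}H : forall m a, (m <= n)%N -> delta * n%:R <= a%:R :> R -> residue_bound q rho m a <= M + eta.
    by near: n; exact: (near_residue_bound_le q_gt0 rho0 rho1 delta0 eta0).
  by apply: H => //; rewrite (le_trans (ltW a0u)) // ler_nat.
have w0 := count_weight_gt0 R q_ge2 ks mn.
have N0 : 0 < 'C(#|'I_n|, m)%:R * #|tuples_with_counts m ks|%:R :> R.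
  by rewrite -(multinomial_card R sk) card_ord mulr_gt0 ?multinomial_gt0 // ltr0n bin_gt0.
have D0 := second_moment_gap M1 eta1.
have D1 : 0 < 2 * M - (M + eta) by rewrite (lt_le_trans _ D0) // divr_gt0.
have tM : M + eta < 2 * M by rewrite -subr_gt0.
have := gprob_no_residue_sets q_gt0 (@bounds 'I_n) m_gt0 ev tau_le (ltW rho0) B0 near_le a0m N0 tM.
move=> h; apply: (le_trans (le_trans _ h)).
  apply: gprob_le => G fG; rewrite -leqn0 leqNgt; apply/negP => r0.
  have := residue_sets_le_f fc r0; rewrite -(ler_nat R) => mf.
  by move: fG; rewrite ltNge (le_trans xm mf).
rewrite -/M mulrA (mean_weight n sk).
have sq : ((M + eta) / (2 * M - (M + eta))) ^+ 2 <= 1 + e / 2.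
  exact: second_moment_ratio_le.
suff Bw : B / (count_weight R n m ks * (2 * M - (M + eta))) <= e / 2.
  by rewrite lerBlDr (le_trans (lerD sq Bw)) // -addrA -splitr addrC.
set w := count_weight R n m ks in w0 *.
have Bl : B <= expR (c / 2 * n%:R + 2 * kz).
  apply: (near_sets_expR_le z0 z1 erefl _ (ltW delta0) _ a0x); first by rewrite (ltW c0).
  by rewrite -delta_kz addrC.
have wl : expR (c * n%:R - 2 * log_error R q n) <= w.
  rewrite -[leRHS]lnK ?posrE // ler_expR.
  have := ln_count_weight_close q_ge2 alpha01 alpha1 mn fc sk; rewrite ler_norml => /andP[h1 _].
  have {}H : forall m, n%:R / (8 * q%:R) <= m%:R :> R -> m%:R + eps / 2 * n%:R <= (k n)%:R ->
      c * n%:R - log_error R q n <= log_weight alpha n m.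
    by near: n; exact: (near_log_weight_below q_ge2 alpha01 alpha1 greatest eps0).
  have mk : m%:R + eps / 2 * n%:R <= (k n)%:R by rewrite -lerBrDr.
  have := lerD (H m m8 mk) h1.
  by rewrite [leRHS]addrCA subrr addr0 -addrA -opprD [2 * _]mulr_natl mulr2n.
(* B is at most exp(c n / 2) up to a constant, while the weight is at least exp(c n) up to a power
   of n; the coefficient of the logarithm collects 2 kz and twice [log_error]. *)
have small : expR (2 * (3 * q%:R + 2 + kz) * (1 + ln n.+1%:R) - c / 2 * n%:R) <= e / 4.
  by near: n; exact: (near_expR_le _ c20 e40).
have L0 : 0 <= ln (n.+1%:R : R) by rewrite ln_ge0 // ler1n.
have w20 : 0 < w * (2 * M - (M + eta)) by rewrite mulr_gt0.
rewrite ler_pdivrMr // (le_trans Bl) //.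
apply: (@le_trans _ _ (e / 2 * (w * (1 / 2)))); last first.
  by rewrite ler_wpM2l ?divr_ge0 ?(ltW e0) // ler_wpM2l // ltW.
have -> : e / 2 * (w * (1 / 2)) = e / 4 * w by field.
apply: (@le_trans _ _ (e / 4 * expR (c * n%:R - 2 * log_error R q n))); last first.
  by rewrite ler_wpM2l // ltW.
apply: (@le_trans _ _ (expR (2 * (3 * q%:R + 2 + kz) * (1 + ln n.+1%:R) - c / 2 * n%:R) *
    expR (c * n%:R - 2 * log_error R q n))); last by rewrite ler_wpM2r ?expR_ge0.
rewrite -expRD ler_expR /log_error.
have -> : 2 * (3 * q%:R + 2 + kz) * (1 + ln n.+1%:R) - c / 2 * n%:R +
    (c * n%:R - 2 * ((3 * q%:R + 2) * (1 + ln n.+1%:R))) =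
    c / 2 * n%:R + 2 * kz + 2 * (kz * ln n.+1%:R) by move: (ln n.+1%:R) => L; field.
by rewrite lerDl !mulr_ge0.
Unshelve. all: by end_near. Qed.

End Concentration.

Local Open Scope classical_set_scope.

Theorem theorem1p2 (R : realType) (q : nat) (hq : (2 <= q)%N)
    (alpha : 'I_q -> R) (halpha : forall i : 'I_q, 0 <= alpha i <= 1)
    (halpha1 : \sum_(i < q) alpha i = 1)
    (k : nat -> nat)
    (hk : \forall n \near \oo, is_greatest_admissible alpha n (k n))
    (eps : R) (heps : 0 < eps) :
  (fun n : nat =>
     Gnp_prob (1 / 2 : R)
       (fun G : sgraph 'I_n =>
          `|(f alpha G)%:R - (k n)%:R| <= eps * n%:R)) @ \oo --> (1 : R).
Proof.
have q0 : (0 : R) < q%:R by rewrite ltr0n ltnW.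
(* Shrinking eps only strengthens the claim and meets the restriction of the lower tail. *)
pose eps' := Num.min eps (8 * q%:R)^-1.
have eps'0 : 0 < eps' by rewrite lt_min heps invr_gt0 mulr_gt0.
have eps'_le : eps' <= (8 * q%:R)^-1 by rewrite ge_min lexx orbT.
have eps'_eps : eps' <= eps by rewrite ge_min lexx.
apply/cvgrPdist_le => e e0; have e20 : 0 < e / 2 by rewrite divr_gt0.
near=> n.
have above : gprob R (fun G : sgraph 'I_n => (k n)%:R + eps' * n%:R <= (f alpha G)%:R) <= e / 2.
  by near: n; exact: (near_f_above hq halpha halpha1 hk eps'0 e20).
have below : gprob R (fun G : sgraph 'I_n => (f alpha G)%:R < (k n)%:R - eps' * n%:R) <= e / 2.
  by near: n; exact: (near_f_below hq halpha halpha1 hk eps'0 eps'_le e20).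
rewrite Gnp_prob_half.
set A : pred (sgraph 'I_n) := fun G => `|_ - _| <= _.
have hC := gprob_setC R A; have C0 := gprob_ge0 R (fun G => ~~ A G).
rewrite -hC ger0_norm //.
pose U (b : bool) (G : sgraph 'I_n) := if b then (k n)%:R + eps' * n%:R <= (f alpha G)%:R
  else (f alpha G)%:R < (k n)%:R - eps' * n%:R.
have sub : forall G, ~~ A G -> exists2 b, predT b & U b G.
  move=> G; rewrite /A -ltNge => h.
  have : eps' * n%:R <= eps * n%:R by rewrite ler_wpM2r.
  move: h; rewrite ltr_normr => /orP[] h1 h2; [exists true|exists false] => //=; lra.
apply: (le_trans (gprob_union_le R sub)); rewrite big_bool /= [leRHS]splitr lerD.
Unshelve. all: by end_near. Qed.
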